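(* Let $\mathbb{K}$ be a countably infinite field and suppose $(V,\rho_V)$ is a reduced diagonalizable $\mathbb{K}^*$-representation with weight spaces $V_1,\ldots,V_s$ and with all weights non-zero. Then, for every $\rho_V^*$-invariant and $\rho_V^*$-ergodic probability measure $\theta$ on $\widehat{V}$, there are linear subspaces $W_1\leq V_1,\ldots,W_s\leq V_s$ such that $$\theta = m_{W_1^\perp}\otimes\cdots\otimes m_{W_s^\perp}.$$
   Context: Let $V$ be a countable (possibly infinite-dimensional) discrete vector space over $\mathbb{K}$ and $\rho_V:\mathbb{K}^*\to\operatorname{GL}(V)$ a linear representation. $(V,\rho_V)$ is diagonalizable if there are linear subspaces $V_1,\ldots,V_s\leq V$ (the weight spaces) and distinct integers $m_1,\ldots,m_s$ (the weights) such that $V = V_1\oplus\cdots\oplus V_s$ and $\rho_V(a)v_i = a^{m_i}v_i$ for all $a\in\mathbb{K}^*$, $v_i\in V_i$. It is reduced if none of $m_1,\ldots,m_s$ is divisible by the characteristic of $\mathbb{K}$ (no condition if $\operatorname{char}(\mathbb{K})=0$). $\widehat{V}=\operatorname{Hom}((V,+),\mathbb{S}^1)$ is the compact metrizable Pontryagin dual, identified with $\widehat{V}_1\times\cdots\times\widehat{V}_s$. The dual representation is $(\rho_V(a)^*\xi)(v)=\xi(\rho_V(a)v)$; $\rho_V^*$-invariance and $\rho_V^*$-ergodicity refer to this action of $\mathbb{K}^*$ on $\widehat{V}$. For a linear subspace $W_i\leq V_i$, $W_i^\perp=\{\xi_i\in\widehat{V}_i : \xi_i|_{W_i}=1\}$,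 and $m_{W_i^\perp}$ is the Haar probability measure of the compact group $W_i^\perp$, viewed as a measure on $\widehat{V}_i$. *)

(* Defs.v *)
From HB Require Import structures.
From mathcomp Require Import all_boot all_order all_algebra.
From mathcomp Require Import complex.
From mathcomp Require Import all_classical all_reals all_analysis.

Set Implicit Arguments.
Unset Strict Implicit.
Unset Printing Implicit Defensive.

Import Order.TTheory GRing.Theory Num.Theory.
Import numFieldNormedType.Exports.

Local Open Scope classical_set_scope.
Local Open Scope ring_scope.

(* The linear subspace S regarded as a vector space of its own. *)
Definition sub_lmod (K : fieldType) (V : lmodType K) (S : submodClosed V) :=
  {v : V | v \in S}.

HB.instance Definition _ (K : fieldType) (V : lmodType K)
  (S : submodClosed V) := SubChoice.on (sub_lmod S).
HB.instance Definition _ (K : fieldType) (V : lmodType K)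
  (S : submodClosed V) := [SubChoice_isSubLmodule of sub_lmod S by <:].

Definition is_character (R : realType) (V : zmodType) (xi : V -> R[i]) : Prop :=
  (forall v, `|xi v| = 1) /\ (forall u v, xi (u + v) = xi u * xi v).

(* The Pontryagin dual of the discrete group V. As V is discrete, every
   homomorphism is continuous and the compact-open topology is the topology of
   pointwise convergence. *)
Definition pdual (R : realType) (V : zmodType) : Type :=
  set_type [set xi : {ptws V -> R[i]^o} | is_character xi].

Definition pdual_fun (R : realType) (V : zmodType) (xi : pdual R V) : V -> R[i] :=
  val xi.
Coercion pdual_fun : pdual >-> Funclass.

Lemma pdual_funP (R : realType) (V : zmodType) (xi : pdual R V) :
  is_character xi.
Proof. exact: (set_mem (valP xi)). Qed.

Definition Pdual (R : realType) (V : zmodType) (f : V -> R[i])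
  (hf : is_character f) : pdual R V :=
  exist _ (f : {ptws V -> R[i]^o}) (mem_set hf).

Lemma is_character1 (R : realType) (V : zmodType) :
  is_character (fun _ : V => 1 : R[i]).
Proof. by split=> [v|u v]; rewrite ?normr1 ?mulr1. Qed.

HB.instance Definition _ (R : realType) (V : zmodType) :=
  Topological.on (pdual R V).
HB.instance Definition _ (R : realType) (V : zmodType) :=
  isPointed.Build (pdual R V) (Pdual (is_character1 R V)).

Lemma is_characterM (R : realType) (V : zmodType) (xi eta : pdual R V) :
  is_character (fun v => xi v * eta v).
Proof.
have [xi1 xiD] := pdual_funP xi; have [eta1 etaD] := pdual_funP eta.
by split=> [v|u v]; rewrite ?normrM ?xi1 ?eta1 ?mulr1// xiD etaD mulrACA.
Qed.

Definition pdual_mul (R : realType) (V : zmodType) (xi eta : pdual R V) :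
  pdual R V := Pdual (is_characterM xi eta).

Lemma is_character_comp (R : realType) (U V : zmodType) (f : {additive U -> V})
  (xi : pdual R V) : is_character (fun u => xi (f u)).
Proof.
have [xi1 xiD] := pdual_funP xi.
by split=> [v|u v]; rewrite ?xi1// raddfD xiD.
Qed.

Definition dual_map (R : realType) (U V : zmodType) (f : {additive U -> V})
  (xi : pdual R V) : pdual R U := Pdual (is_character_comp f xi).

Definition borel (T : ptopologicalType) := g_sigma_algebraType (@open T).

HB.instance Definition _ (T : ptopologicalType) :=
  Measurable.copy (borel T) (g_sigma_algebraType (@open T)).

Definition annihilator (R : realType) (V : zmodType) (W : {pred V}) :
  set (pdual R V) := [set xi | forall w, w \in W -> xi w = 1].

(* The image in pdual R V of the Haar probability measure of a closed
   subgroup H: the unique Borel probability measure that is carried by H and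
   is invariant under translation by the elements of H. *)
Definition is_haar_probability (R : realType) (V : zmodType)
  (H : set (pdual R V)) (mu : probability (borel (pdual R V)) R) : Prop :=
  mu H = 1%E /\
  forall eta (A : set (borel (pdual R V))), H eta -> measurable A ->
    mu (pdual_mul eta @^-1` A) = mu A.

(* K^* is the set of units of K; the value of rho at 0 is irrelevant. Each
   rho a with a != 0 is invertible, with inverse rho a^-1. *)
Definition is_representation (K : fieldType) (V : lmodType K)
  (rho : K -> {linear V -> V}) : Prop :=
  rho 1 =1 id /\
  forall a b, a != 0 -> b != 0 -> rho (a * b) =1 rho a \o rho b.

Definition is_direct_sum (K : fieldType) (V : lmodType K) (s : nat)
  (Vs : 'I_s -> submodClosed V) : Prop :=
  forall v : V, exists! u : {ffun 'I_s -> V},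
    (forall i, u i \in Vs i) /\ v = \sum_(i < s) u i.

Definition is_weight_decomposition (K : fieldType) (V : lmodType K)
  (rho : K -> {linear V -> V}) (s : nat) (Vs : 'I_s -> submodClosed V)
  (m : 'I_s -> int) : Prop :=
  [/\ is_direct_sum Vs,
      injective m &
      forall a i v, a != 0 -> v \in Vs i -> rho a v = a ^ m i *: v].

Definition reduced_weights (K : fieldType) (s : nat) (m : 'I_s -> int) : Prop :=
  forall p i, p \in [pchar K] -> ~~ (p%:Z %| m i)%Z.

Definition dual_invariant (R : realType) (K : fieldType) (V : lmodType K)
  (rho : K -> {linear V -> V}) (theta : probability (borel (pdual R V)) R) :
  Prop :=
  forall a (A : set (borel (pdual R V))), a != 0 -> measurable A ->
    theta (dual_map (rho a) @^-1` A) = theta A.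

Definition dual_ergodic (R : realType) (K : fieldType) (V : lmodType K)
  (rho : K -> {linear V -> V}) (theta : probability (borel (pdual R V)) R) :
  Prop :=
  forall A : set (borel (pdual R V)), measurable A ->
    (forall a, a != 0 -> dual_map (rho a) @^-1` A = A) ->
    theta A = 0%E \/ theta A = 1%E.

(* theta is the product of the mu i, with xi in the dual of V identified with
   the family of its restrictions to the Vs i; a product measure is determined
   by its values on measurable rectangles. *)
Definition is_product_measure (R : realType) (K : fieldType) (V : lmodType K)
  (s : nat) (Vs : 'I_s -> submodClosed V)
  (theta : probability (borel (pdual R V)) R)
  (mu : forall i, probability (borel (pdual R (sub_lmod (Vs i)))) R) : Prop :=
  forall A : forall i, set (borel (pdual R (sub_lmod (Vs i)))),
    (forall i, measurable (A i)) ->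
    theta [set xi | forall i, A i (dual_map (\val : sub_lmod (Vs i) -> V) xi)] =
    (\prod_(i < s) mu i (A i))%E.

(* Main.v *)
Require Import Defs.
From HB Require Import structures.
From mathcomp Require Import all_boot all_order all_algebra.
From mathcomp Require Import complex.
From mathcomp Require Import all_classical all_reals all_analysis.
From mathcomp Require Import measurable_realfun ring lra.

Set Implicit Arguments.
Unset Strict Implicit.
Unset Printing Implicit Defensive.

Import Order.TTheory GRing.Theory Num.Theory.
Import numFieldNormedType.Exports.

Local Open Scope classical_set_scope.
Local Open Scope ring_scope.

(** The theorem is a statement about the Fourier coefficients phi v of theta, the
integrals of xi v over theta. A finite Borel measure on the dual of V is determined
by its Fourier coefficients, and those of the product of the Haar measures of the
annihilators of the W_i are the values of the indicator function of
W_1 + ... + W_s.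

For v in V_i the group acts on the line K v through scalars, so the set of the
characters that are trivial on K v is invariant, and by ergodicity its measure is
0 or 1. Let W_i consist of the v for which it is 1. If u_i is in W_i for all i, then
xi (u_1 + ... + u_s) = 1 for almost every xi. It remains to see that
phi (u_1 + ... + u_s) = 0 if some u_i is not in W_i ([fourier_vanish]). Components
in W_i may be dropped, so all u_i that occur are outside W_i: almost every xi is
nontrivial on K u_i, and the averages of xi (x u_i) over suitable finite sets of x in
K are small ([small_line_averages]).

The other ingredients are the invariance of phi under the group and the inequality
of Cauchy-Schwarz in the form |sum_a phi (w_a)|^2 <= sum_a sum_b phi (w_a - w_b).
They are used in two ways. First, phi (u) is equal to phi at x + h acting on u, for
all x and h; Cauchy-Schwarz over h shows that it is enough to make averages over x
of phi at ((x + h) ^ m_i - (x + h') ^ m_i) u_i, summed over i, small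
([vanishing_from_shifts]). Secondly, if a function q of x with values in V has a
monomial x ^ n with coefficient in V_i, then replacing x by a ^ m_i x and letting
a ^- n act on the result preserves this monomial; Cauchy-Schwarz over a replaces q by
differences in which the monomial is absent ([eliminate_monomial]).

If all weights are positive, all monomials can be eliminated except the linear one
in the coordinate of the largest weight m_i. Its coefficient contains the factor m_i,
and this is where the weights have to be prime to the characteristic; the average of
what is left is an average along a line ([positive_weights_vanish]). For the rest of that coefficient to be nonzero the weights have to be
larger than 1, which is achieved by restricting the action to squares or cubes
([weights_vanish]). The group element 1 / a in place of a settles the case that all
weights are negative. If both signs
occur, all monomials in the coordinates of positive weights are eliminated. Those of
negative weights are rational functions of x that keep a pole, so they are nonzero for
almost all x, and phi vanishes there by the case of negative weights
([mixed_weights_vanish]).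

Finally, let mu_i be the image of theta under restriction to V_i. The values of phi
show that mu_i is invariant under translation by the annihilator of W_i
([haar_from_fourier]) and that the restrictions are independent
([rectangle_integral]); both follow from [functional_borel], by which a functional
such as a difference of two measures is zero if it kills all characters. *)

(** * Generic choices in an infinite field *)

Lemma sum_sqr_le (R : realFieldType) (T : Type) (X : seq T) (f : T -> R) :
  (\sum_(x <- X) f x) ^+ 2 <= (size X)%:R * \sum_(x <- X) f x ^+ 2.
Proof.
elim: X => [|a X IH]; first by rewrite !big_nil expr0n mulr0.
rewrite !big_cons /= -natr1.
have [X0|] := posnP (size X).
  by rewrite (size0nil X0) !big_nil /= !addr0 add0r mul1r.
rewrite -(ltr0n R); move: IH (f a); move: (\sum_(_ <- _) _) (\sum_(_ <- _) _) => t s.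
move: (size X)%:R => n stn b n0.
have key : 2 * b * s <= n * b ^+ 2 + t.
  by rewrite -(ler_pM2l n0); have := sqr_ge0 (n * b - s); lra.
lra.
Qed.

Section greedy.
Variable K : fieldType.
Hypothesis infK : forall B : seq K, exists x, x \notin B.

(** The generic parameters needed below (shifts, scaling factors) are chosen one
after the other, each outside the finitely many values that its predecessors
forbid. *)
Lemma greedy_choice (F : K -> seq K) (B : seq K) (N : nat) :
  exists g : 'I_N -> K, (forall a, g a \notin B) /\
    (forall a b : 'I_N, (a < b)%N -> g b \notin F (g a)).
Proof.
suff [s [sN sB sF]] : exists s : seq K, [/\ size s = N,
    {in s, forall x, x \notin B} & pairwise (fun a b => b \notin F a) s].
  exists (fun a => nth 0 s a); split=> [a|a b ab].
    by apply: sB; rewrite mem_nth // sN.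
  by move/(pairwiseP 0): sF; apply; rewrite ?inE ?sN.
elim: N => [|N [s [sN sB sF]]]; first by exists [::].
have [x] := infK (B ++ flatten [seq F y | y <- s]).
rewrite mem_cat negb_or => /andP[xB xF].
exists (rcons s x); split; first by rewrite size_rcons sN.
  by move=> y; rewrite mem_rcons inE => /predU1P[->//|]; exact: sB.
rewrite pairwise_rcons sF andbT; apply/allP => y ys.
apply: contra xF => xFy; apply/flattenP; exists (F y) => //.
exact: map_f.
Qed.

Lemma generic_ratios (B : seq K) (N : nat) :
  exists g : 'I_N -> K, (forall a, g a != 0) /\
    (forall a b : 'I_N, a != b -> g b / g a \notin B).
Proof.
have [g [g0 gF]] := greedy_choice
  (fun y => [seq b * y | b <- B] ++ [seq y / b | b <- B]) [:: 0] N.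
have {}g0 a : g a != 0 by have := g0 a; rewrite inE.
exists g; split=> // a b; rewrite neq_ltn => /orP[] /gF;
    rewrite mem_cat negb_or => /andP[].
  move=> /mapP gB _; apply/negP => bB; apply: gB.
  by exists (g b / g a); rewrite ?divfK.
move=> _ /mapP gB; apply/negP => bB; apply: gB.
by exists (g b / g a); rewrite // invf_div mulrC divfK.
Qed.
End greedy.

(** * Eliminating monomials from averages over the field *)

Section elimination.
Variables (R : archiRealFieldType) (K : fieldType) (I : finType) (m : I -> int).
Notation vec := {ffun I -> K}.
Implicit Types (C : vec -> R) (G : (K -> vec) -> Prop).

(** A vector r stands for the element sum_i r_i u_i of V, for fixed u_i in the
weight spaces; on it the group acts by [dilate]. *)
Definition dilate (t : K) (r : vec) : vec := [ffun i => t ^ m i * r i].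

Definition single (i : I) (c : K) : vec := [ffun j => if j == i then c else 0].

(** One sample X has to serve for all members of a finite family at once: each
Cauchy-Schwarz step replaces a function by finitely many others. The bound is
one-sided because C enters as an upper bound for a square. *)
Definition small_averages C G := forall (J : finType) (q : J -> K -> vec)
  (B : seq K) (e : R), (forall j, G (q j)) -> 0 < e ->
  exists X : seq K, [/\ X != [::], {in X, forall x, x \notin B} &
    forall j, \sum_(x <- X) C (q j x) <= e * (size X)%:R].

(** The twist by a composes q with the scaling x |-> a ^ (m i) x of the parameter
and lets a ^- n act on the values, which an invariant C does not notice. It fixes
the monomial x ^ n in the coordinate i, so that this monomial disappears from the
difference of two twists. *)
Definition twisted_difference (i : I) (n : nat) (a b : K) (q : K -> vec) x :=
  dilate (a ^- n) (q (a ^ m i * x)) - dilate (b ^- n) (q (b ^ m i * x)).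

(** Stability is required for generic a and b only: a remainder that must not
vanish may well cancel for finitely many ratios b / a. *)
Definition twist_stable (i : I) (n : nat) G := forall q, G q ->
  exists B : seq K, forall a b, a != 0 -> b != 0 -> b / a \notin B ->
    G (twisted_difference i n a b q).

Definition plus_monomial (i : I) (n : nat) G q := exists (c : K) g,
  G g /\ q = fun x => single i (c * x ^+ n) + g x.

(** What positive definiteness of the Fourier transform gives by Cauchy-Schwarz:
if C is the real part of the Fourier transform of a measure, this holds for its
real and for its imaginary part S. *)
Definition square_dominated (S C : vec -> R) := forall N (u : 'I_N -> vec),
  (\sum_a S (u a)) ^+ 2 <= \sum_a \sum_b C (u a - u b).

Definition dilation_invariant C := forall a r, a != 0 -> C (dilate a r) = C r.

Lemma dilateD a r r' : dilate a (r + r') = dilate a r + dilate a r'.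
Proof. by apply/ffunP => i; rewrite !ffunE mulrDr. Qed.

Lemma dilate_single a i c : dilate a (single i c) = single i (a ^ m i * c).
Proof. by apply/ffunP => j; rewrite !ffunE; case: eqP => [->|]; rewrite ?mulr0. Qed.

Lemma singleB i c d : single i c - single i d = single i (c - d).
Proof. by apply/ffunP => j; rewrite !ffunE; case: eqP => // _; rewrite subr0. Qed.

Lemma twist_monomial i n i' n' a b c (g : K -> vec) x :
  twisted_difference i n a b (fun x => single i' (c * x ^+ n') + g x) x =
  single i' (((a ^- n) ^ m i' * (a ^ m i) ^+ n' -
              (b ^- n) ^ m i' * (b ^ m i) ^+ n') * c * x ^+ n') +
  twisted_difference i n a b g x.
Proof.
rewrite /twisted_difference !dilateD opprD addrACA !dilate_single singleB.
by congr (single _ _ + _); rewrite !exprMn; ring.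
Qed.

Lemma twist_same i n a : a != 0 -> (a ^- n) ^ m i * (a ^ m i) ^+ n = 1 :> K.
Proof.
move=> a0; rewrite exprnN exprzAC -exprnN mulVf //.
by rewrite expf_neq0 // expfz_neq0.
Qed.

Lemma plus_monomial_stable i n i' n' G :
  twist_stable i n G -> twist_stable i n (plus_monomial i' n' G).
Proof.
move=> stG _ [c [g [Gg ->]]]; have [B BG] := stG _ Gg.
exists B => a b a0 b0 ab; eexists; eexists; split; first exact: (BG _ _ a0 b0 ab).
apply: funext => x; exact: twist_monomial.
Qed.
End elimination.

Section elimination_step.
Variables (R : archiRealFieldType) (K : fieldType) (I : finType) (m : I -> int).
Notation vec := {ffun I -> K}.
Variable C : vec -> R.
Hypothesis infK : forall B : seq K, exists x, x \notin B.
Hypothesis C0 : C 0 = 1.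
Hypothesis Cpos : square_dominated C C.
Hypothesis Cinv : dilation_invariant m C.

Lemma archi_inv (e : R) : 0 < e -> exists2 N : nat, (0 < N)%N & N%:R^-1 <= e.
Proof.
move=> e0; have [N Ne] : exists N : nat, e^-1 < N%:R.
  exists (Num.bound e^-1); apply: archi_boundP; by rewrite invr_ge0 ltW.
have N0 : 0 < N%:R :> R by apply: lt_trans Ne; rewrite invr_gt0.
by exists N; [rewrite -(ltr0n R)|rewrite -[e]invrK lef_pV2 ?posrE ?invr_gt0 // ltW].
Qed.

(** Average C (q x) over x = a ^ (m i) y, with y in a sample and a in a generic
finite set. By invariance C may be evaluated at the twists of q instead;
Cauchy-Schwarz over a bounds the square of the average by averages of C at
differences of two twists, from which the monomial is gone, plus the inverse of the
number of factors a for the diagonal terms. *)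
Lemma eliminate_monomial i n G : m i != 0 -> twist_stable m i n G ->
  small_averages C G -> small_averages C (plus_monomial i n G).
Proof.
move=> mi stG smG J q B e qG e0.
have /choice[c /choice[g gP]] := qG.
have Gg j : G (g j) by case: (gP j).
have /choice[D DP] : forall j, exists D : seq K, forall a b, a != 0 -> b != 0 ->
    b / a \notin D -> G (twisted_difference m i n a b (g j)).
  by move=> j; exact: stG.
(* The bound e ^ 2 for the square is shared equally between the diagonal and the
   off-diagonal terms. *)
have e20 : 0 < e ^+ 2 / 2 by rewrite divr_gt0 ?exprn_gt0.
have [N N0 Ne] := archi_inv e20.
have [a [a0 aD]] := generic_ratios infK (flatten [seq D j | j <- enum J]) N.
pose P := {p : 'I_N * 'I_N | p.1 != p.2}.
pose q' (k : J * P) := twisted_difference m i n (a (val k.2).1) (a (val k.2).2) (g k.1).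
have q'G k : G (q' k).
  case: k => j [[k l] /= kl]; rewrite /q' /=; apply: DP => //.
  apply: contra (aD _ _ kl) => akl; apply/flattenP; exists (D j) => //.
  by apply: map_f; rewrite mem_enum.
have [X [Xn XB Xq]] := smG _ q' [seq a k ^ (- m i) * x | x <- B, k <- enum 'I_N] _ q'G e20.
exists [seq a k ^ m i * x | x <- X, k <- enum 'I_N]; split.
- case: X Xn {XB Xq} => //= x X _.
  case: (enum 'I_N) (size_enum_ord N) => //= sN.
  by rewrite -sN in N0.
- move=> _ /allpairsP[[x k] /= [xX _ ->]]; apply: contra (XB _ xX) => aB.
  apply/allpairsP; exists (a k ^ m i * x, k) => /=; rewrite mem_enum; split=> //.
  by rewrite mulrA -expfzDr // addNr expr0z mul1r.
move=> j; rewrite size_allpairs size_enum_ord big_allpairs_dep /=.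
pose u x k := dilate m (a k ^- n) (q j (a k ^ m i * x)).
have uE x k : C (q j (a k ^ m i * x)) = C (u x k).
  by rewrite Cinv // invr_eq0 expf_neq0.
under eq_bigr do under eq_bigr do rewrite uE.
have diff k l x : u x k - u x l = twisted_difference m i n (a k) (a l) (g j) x.
  rewrite /u; have [_ ->] := gP j.
  have := twist_monomial m i n i n (a k) (a l) (c j) (g j) x.
  rewrite {1}/twisted_difference => ->.
  rewrite !twist_same // subrr !mul0r.
  suff -> : single i (0 : K) = 0 by rewrite add0r.
  by apply/ffunP => k'; rewrite !ffunE; case: ifP.
set s := size X; have s0 : 0 < s%:R :> R.
  by rewrite ltr0n /s; case: (X) Xn.
have N0' : 0 < N%:R :> R by rewrite ltr0n.
rewrite natrM mulrA.
have main : (\sum_(x <- X) \sum_(k <- enum 'I_N) C (u x k)) ^+ 2 <=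
    s%:R * (N%:R * s%:R + N%:R * N%:R * (e ^+ 2 / 2 * s%:R)).
  apply: le_trans (sum_sqr_le _ _) _; rewrite ler_pM2l //.
  apply: (@le_trans _ _ (\sum_(x <- X) \sum_k \sum_l C (u x k - u x l))).
    by apply: ler_sum => x _; rewrite big_enum /=; exact: Cpos.
  rewrite exchange_big /=.
  under eq_bigr do rewrite exchange_big /=.
  apply: (@le_trans _ _ (\sum_(k < N) \sum_(l < N)
      ((k == l)%:R * s%:R + e ^+ 2 / 2 * s%:R))).
    apply: ler_sum => k _; apply: ler_sum => l _.
    have [->|kl] := eqVneq k l.
      under eq_bigr do rewrite subrr C0.
      rewrite big_const_seq count_predT iter_addr addr0 mul1r lerDl.
      by rewrite mulr_ge0 ?ltW.
    rewrite mul0r add0r; under eq_bigr do rewrite diff.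
    exact: (Xq (j, exist _ (k, l) kl)).
  have rowE (k : 'I_N) : \sum_(l < N) ((k == l)%:R * s%:R + e ^+ 2 / 2 * s%:R) =
      s%:R + N%:R * (e ^+ 2 / 2 * s%:R) :> R.
    rewrite big_split /= sumr_const card_ord mulr_natl (bigD1 k) //= eqxx mul1r.
    by rewrite big1 ?addr0 // => l; rewrite eq_sym => /negPf ->; rewrite mul0r.
  under eq_bigr do rewrite rowE.
  by rewrite sumr_const card_ord -[leLHS]mulr_natl mulrDr mulrA.
have bound : s%:R * (N%:R * s%:R + N%:R * N%:R * (e ^+ 2 / 2 * s%:R)) <=
    (e * s%:R * N%:R) ^+ 2.
  have Ns : 1 <= e ^+ 2 / 2 * N%:R by rewrite -ler_pdivrMr // mul1r.
  have : 0 <= (s%:R ^+ 2 * N%:R) * (e ^+ 2 / 2 * N%:R - 1).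
    by rewrite mulr_ge0 ?subr_ge0 // mulr_ge0 ?exprn_ge0 // ltW.
  by move: (s%:R : R) (N%:R : R) => s' N'; lra.
apply: le_trans (ler_norm _) _; rewrite -ler_sqr ?nnegrE //; last first.
  by rewrite !mulr_ge0 // ltW.
by rewrite real_normK ?num_real //; exact: le_trans main bound.
Qed.
End elimination_step.

(** * From shifts of the parameter to vanishing *)

Section equidistribution.
Variables (R : archiRealFieldType) (K : fieldType) (I : finType).
Notation vec := {ffun I -> K}.
Hypothesis infK : forall B : seq K, exists x, x \notin B.

(** The remainder for weights of one sign: a single linear term. *)
Definition line (i : I) (q : K -> vec) :=
  exists c, c != 0 /\ q = fun x => single i (c * x).

Lemma poly_roots_seq (p : {poly K}) : p != 0 ->
  exists s : seq K, forall x, root p x -> x \in s.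
Proof.
move: {2}(size p) (leqnn (size p)) => n; elim: n p => [|n IH] p.
  by rewrite size_poly_leq0 => /eqP ->; rewrite eqxx.
move=> sp p0; have [[a /factor_theorem[q pE]]|noroot] := pselect (exists a, root p a).
  have q0 : q != 0 by apply: contraNneq p0 => q0; rewrite pE q0 mul0r.
  have [|s sP] := IH q _ q0.
    by move: sp; rewrite pE size_Mmonic ?monicXsubC // size_XsubC addn2.
  exists (a :: s) => x; rewrite pE rootM root_XsubC inE => /orP[/sP ->|->] //.
  by rewrite orbT.
by exists [::] => x px; case: noroot; exists x.
Qed.

Lemma power_roots_seq (n : nat) (c : K) : (0 < n)%N ->
  exists s : seq K, forall x, x ^+ n = c -> x \in s.
Proof.
move=> n0; have [|s sP] := @poly_roots_seq ('X^n - c%:P).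
  by rewrite -size_poly_eq0 size_XnsubC.
by exists s => x xc; apply: sP; rewrite rootE !hornerE xc subrr.
Qed.

Lemma zpower_eq1_seq (e : int) : e != 0 ->
  exists s : seq K, forall x, x ^ e = 1 -> x \in s.
Proof.
move=> e0; have [|s sP] := @power_roots_seq `|e|%N 1; first by rewrite absz_gt0.
exists s => x xe; apply: sP; case: e xe {e0} => [n|n] /=; first by rewrite -exprnP.
by move=> /(congr1 (@GRing.inv K)); rewrite invr1 /exprz invrK.
Qed.

Section averaging.
Variables (m : I -> int) (C S : vec -> R).
Hypothesis C0 : C 0 = 1.
Hypothesis Spos : square_dominated S C.
Hypothesis Sinv : dilation_invariant m S.

(** Van der Corput step. By invariance S r is equal to S at (x + h) acting on r, for
every x and every shift h; averaging over x and over the shifts, Cauchy-Schwarz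
bounds S r ^ 2 by averages of C at differences of two shifts, up to the diagonal
terms, whose share tends to 0 with the number of shifts. *)
Lemma vanishing_from_shifts (r : vec) (G : (K -> vec) -> Prop) :
  (forall N, exists h : 'I_N -> K, forall a b, a != b ->
    G (fun x => dilate m (x + h a) r - dilate m (x + h b) r)) ->
  small_averages C G -> S r = 0.
Proof.
move=> shifts smG; apply/eqP; rewrite -sqrf_eq0 eq_le sqr_ge0 andbT.
rewrite leNgt; apply/negP => Sr0.
(* Diagonal and off-diagonal terms contribute at most a third of S r ^ 2 each, which
   leaves a third for the contradiction. *)
have e0 : 0 < S r ^+ 2 / 3 by rewrite divr_gt0.
have [N N0 Ne] := archi_inv e0.
have [h hG] := shifts N.
pose P := {p : 'I_N * 'I_N | p.1 != p.2}.
pose q (k : P) x := dilate m (x + h (val k).1) r - dilate m (x + h (val k).2) r.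
have [X [Xn XB Xq]] := smG _ q [seq - h a | a <- enum 'I_N] _
  (fun k => hG _ _ (valP k)) e0.
set s := size X; have s0 : 0 < s%:R :> R.
  by rewrite ltr0n /s; case: (X) Xn.
have N0' : 0 < N%:R :> R by rewrite ltr0n.
have : \sum_(x <- X) (N%:R * S r) ^+ 2 <=
    \sum_(a < N) \sum_(b < N) ((a == b)%:R * s%:R + S r ^+ 2 / 3 * s%:R).
  apply: (@le_trans _ _ (\sum_(x <- X) \sum_a \sum_b
      C (dilate m (x + h a) r - dilate m (x + h b) r))).
    rewrite big_seq [leRHS]big_seq; apply: ler_sum => x xX.
    apply: le_trans (Spos _).
    under [X in _ <= X ^+ 2]eq_bigr => a _.
      rewrite Sinv; first over.
      apply: contra (XB _ xX); rewrite addr_eq0 => /eqP ->.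
      by apply: map_f; rewrite mem_enum.
    by rewrite sumr_const card_ord mulr_natl.
  rewrite exchange_big /=; under eq_bigr do rewrite exchange_big /=.
  apply: ler_sum => k _; apply: ler_sum => l _.
  have [->|kl] := eqVneq k l.
    under eq_bigr do rewrite subrr C0.
    rewrite big_const_seq count_predT iter_addr addr0 mul1r lerDl.
    by rewrite mulr_ge0 ?ltW.
  rewrite mul0r add0r.
  exact: (Xq (exist _ (k, l) kl)).
have rowE (k : 'I_N) : \sum_(l < N) ((k == l)%:R * s%:R + S r ^+ 2 / 3 * s%:R) =
    s%:R + N%:R * (S r ^+ 2 / 3 * s%:R) :> R.
  rewrite big_split /= sumr_const card_ord mulr_natl (bigD1 k) //= eqxx mul1r.
  by rewrite big1 ?addr0 // => l; rewrite eq_sym => /negPf ->; rewrite mul0r.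
under [leRHS]eq_bigr do rewrite rowE.
rewrite sumr_const card_ord -[leRHS]mulr_natl big_const_seq count_predT iter_addr addr0.
rewrite -[leLHS]mulr_natr -/s => main.
have Ns : 1 <= S r ^+ 2 / 3 * N%:R by rewrite -ler_pdivrMr // mul1r.
have : 0 <= (s%:R * N%:R) * (S r ^+ 2 / 3 * N%:R - 1).
  by rewrite mulr_ge0 ?subr_ge0 // mulr_ge0 ?exprn_ge0 // ltW.
have : 0 < S r ^+ 2 * s%:R * N%:R * N%:R by do 3! apply: mulr_gt0 => //.
by move: main; move: (s%:R : R) (N%:R : R) (S r) => s' N' y; lra.
Qed.
End averaging.

Definition add_monomials (L : seq (I * nat)) (G : (K -> vec) -> Prop) :=
  foldr (fun l => plus_monomial l.1 l.2) G L.

Lemma add_monomials_sum L G (c : I * nat -> K) g : G g ->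
  add_monomials L G (fun x => \sum_(l <- L) single l.1 (c l * x ^+ l.2) + g x).
Proof.
move=> Gg; elim: L => [|l L IH] /=.
  by under eq_fun do rewrite big_nil add0r.
exists (c l); eexists; split; first exact: IH.
by apply: funext => x; rewrite big_cons addrA.
Qed.

Section elimination_of_all.
Variables (m : I -> int) (C : vec -> R).
Hypothesis C0 : C 0 = 1.
Hypothesis Cpos : square_dominated C C.
Hypothesis Cinv : dilation_invariant m C.

(** A remainder stays stable when monomials are added to it, so that the
monomials can be eliminated one at a time. *)
Lemma eliminate_monomials (L : seq (I * nat)) G :
  (forall l, l \in L -> m l.1 != 0) ->
  (forall l, l \in L -> twist_stable m l.1 l.2 G) ->
  small_averages C G -> small_averages C (add_monomials L G).
Proof.
elim: L => [|l L IH] //= Lm LG smG.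
apply: (eliminate_monomial infK C0 Cpos Cinv).
- by apply: Lm; rewrite mem_head.
- have : twist_stable m l.1 l.2 G by apply: LG; rewrite mem_head.
  by elim: (L) => //= l' L' IH' /IH'; exact: plus_monomial_stable.
- by apply: IH => // k kL; [apply: Lm|apply: LG]; rewrite inE kL orbT.
Qed.

(** The linear term c x in the coordinate i0 becomes a multiple of
a ^ (m i - n m_i0) - b ^ (m i - n m_i0), which vanishes only if b / a is a root of
unity of a bounded order. *)
Lemma line_twist_stable i0 i n : m i != n%:Z * m i0 ->
  twist_stable m i n (line i0).
Proof.
move=> min _ [c [c0 ->]].
have [|B BP] := @zpower_eq1_seq (m i - n%:Z * m i0); first by rewrite subr_eq0.
exists B => a b a0 b0 ab.
exists (((a ^- n) ^ m i0 * a ^ m i - (b ^- n) ^ m i0 * b ^ m i) * c); split.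
  rewrite mulf_neq0 // subr_eq0; apply: contraNneq ab => ab; apply: BP.
  have pE (y : K) : y != 0 -> (y ^- n) ^ m i0 * y ^ m i = y ^ (m i - n%:Z * m i0).
    move=> y0; rewrite exprnN exprz_exp.
    by rewrite -(expfzDr _ _ y0) addrC mulNr.
  by move: ab; rewrite !pE // => ab; rewrite expfzMl -ab -expfzMl divff // exp1rz.
apply: funext => x.
rewrite /twisted_difference !dilate_single singleB.
by congr single; ring.
Qed.
End elimination_of_all.
End equidistribution.

(** * Weights of one sign *)

Section polynomial_parts.
Variables (K : fieldType) (I : finType).
Notation vec := {ffun I -> K}.

Lemma single_sum (T : Type) (s : seq T) (i : I) (F : T -> K) :
  \sum_(t <- s) single i (F t) = single i (\sum_(t <- s) F t).
Proof.
apply/ffunP => j; rewrite sum_ffunE !ffunE; under eq_bigr do rewrite ffunE.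
by case: ifP => // _; rewrite big1.
Qed.

Lemma vec_decomposition (v : vec) : v = \sum_i single i (v i).
Proof.
apply/ffunP => j; rewrite sum_ffunE (bigD1 j) //= ffunE eqxx big1 ?addr0 // => i.
by rewrite ffunE eq_sym => /negPf ->.
Qed.

Lemma exprD_bounded (x h : K) (n M : nat) : (n < M)%N ->
  (x + h) ^+ n = \sum_(0 <= k < M) h ^+ (n - k) *+ 'C(n, k) * x ^+ k.
Proof.
move=> nM; rewrite addrC exprDn (big_cat_nat (n := n.+1)) //=.
rewrite [X in _ = _ + X]big_nat [X in _ = _ + X]big1 => [|k /andP[nk _]]; last first.
  by rewrite bin_small // mulr0n mul0r.
by rewrite addr0 big_mkord; apply: eq_bigr => k _; rewrite -mulrnAl.
Qed.

Definition shift_coef (n : I -> nat) (r : vec) (h h' : K) (l : I * nat) : K :=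
  (h ^+ (n l.1 - l.2) - h' ^+ (n l.1 - l.2)) *+ 'C(n l.1, l.2) * r l.1.

(** The binomial expansion of ((x + h) - (x + h')) acting on r, as a sum over all
monomials of degree below a common bound M. *)
Lemma shift_difference (n : I -> nat) (r : vec) (h h' : K) M (P : {pred I}) x :
  (forall i, i \in P -> (n i < M)%N) ->
  \sum_(i in P) single i (((x + h) ^+ n i - (x + h') ^+ n i) * r i) =
  \sum_(l <- [seq (i, k) | i <- enum P, k <- index_iota 0 M])
    single l.1 (shift_coef n r h h' l * x ^+ l.2).
Proof.
move=> nM; rewrite big_allpairs_dep /= big_enum_cond /=.
apply: eq_big => [i|i iP]; first by rewrite andbT.
rewrite single_sum; congr single.
rewrite !(exprD_bounded _ _ (nM _ iP)) -sumrB mulr_suml.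
by apply: eq_bigr => k _; rewrite /shift_coef /= mulrnBl; ring.
Qed.
End polynomial_parts.

Section one_sided_weights.
Variables (R : archiRealFieldType) (K : fieldType) (I : finType).
Notation vec := {ffun I -> K}.
Hypothesis infK : forall B : seq K, exists x, x \notin B.
Variables (m : I -> int) (C S : vec -> R).
Hypothesis C0 : C 0 = 1.
Hypothesis Cpos : square_dominated C C.
Hypothesis Cinv : dilation_invariant m C.
Hypothesis Spos : square_dominated S C.
Hypothesis Sinv : dilation_invariant m S.
Hypothesis m_inj : injective m.

(** Let i0 be the index of the largest weight. In the difference of the shifts h and
h' all monomials except the linear one in the coordinate i0 can be eliminated:
m_i = n m_i0 would force n = 1 and i = i0. The linear one has the coefficient
m_i0 (h ^ (m_i0 - 1) - h' ^ (m_i0 - 1)) r_i0; it is nonzero for generic h and h'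
since m_i0 > 1 and the characteristic does not divide m_i0. *)
Lemma positive_weights_vanish (r : vec) : r != 0 ->
  (forall i, r i != 0 -> [/\ 1 < m i, (m i)%:~R != 0 :> K &
                             small_averages C (line i)]) -> S r = 0.
Proof.
move=> r0 rP.
have [i1 ri1] : exists i, r i != 0.
  apply/existsP; apply: contra_neqT r0 => /existsPn r0; apply/ffunP => i.
  by rewrite ffunE; apply/eqP; have := r0 i; rewrite negbK.
pose n i := `|m i|%N.
have nE i : r i != 0 -> m i = n i.
  by move=> /rP[mi _ _]; rewrite /n gez0_abs // ltW // (lt_trans _ mi).
case: (@arg_maxnP _ i1 (fun i => r i != 0) n ri1) => i0 ri0 i0max.
have n0 : (1 < n i0)%N by have [] := rP _ ri0; rewrite nE.
pose M := (n i0).+1.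
pose supp : {pred I} := [pred i | r i != 0].
have nM i : i \in supp -> (n i < M)%N by move=> /i0max.
pose Lf := [seq (i, k) | i <- enum supp, k <- index_iota 0 M].
have Lf_uniq : uniq Lf.
  by apply: allpairs_uniq; rewrite ?enum_uniq ?iota_uniq // => -[? ?] [? ?].
have Lf0 : (i0, 1%N) \in Lf.
  apply/allpairsP; exists (i0, 1%N); rewrite mem_enum mem_index_iota; split => //.
  by rewrite /M /= ltnS ltnW.
pose L := [seq l <- Lf | l != (i0, 1%N)].
have Lsupp l : l \in L -> r l.1 != 0.
  by rewrite mem_filter => /andP[_ /allpairsP[[i k] /= [+ _ ->]]]; rewrite mem_enum.
have [_ nK0 small0] := rP _ ri0.
apply: (vanishing_from_shifts C0 Spos Sinv (r := r)
          (G := add_monomials L (line i0))); last first.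
  apply: (eliminate_monomials infK C0 Cpos Cinv) => // -[i k] /[dup] /Lsupp /= ri.
    by move=> _; have [mi _ _] := rP _ ri; rewrite gt_eqF // (lt_trans _ mi).
  rewrite mem_filter => /andP[lk _]; apply: line_twist_stable.
  rewrite !nE // -PoszM; apply/eqP => -[nik].
  have nn : (n i <= n i0)%N := i0max _ ri; rewrite nik in nn.
  (* k = 0, k = 1 and k > 1 contradict m i > 1, injectivity of m and maximality of
     m i0, respectively. *)
  case: k lk nik nn => [|[|k]] lk nik nn.
  - by have [+ _ _] := rP _ ri; rewrite nE // nik.
  - rewrite mul1n in nik; move: lk; rewrite xpair_eqE andbT => /negP; apply.
    by apply/eqP/m_inj; rewrite !nE // nik.
  - by move: nn; rewrite leqNgt ltn_Pmull // ltnW.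
move=> N.
have /choice[F FP] (y : K) : exists s : seq K, forall x,
    x ^+ (n i0).-1 = y ^+ (n i0).-1 -> x \in s.
  by apply: power_roots_seq; rewrite -subn1 subn_gt0.
have [h [_ hF]] := greedy_choice infK F [::] N.
exists h => a b ab.
have hab : h a ^+ (n i0).-1 != h b ^+ (n i0).-1.
  move: ab; rewrite neq_ltn => /orP[] /hF; apply: contra => /eqP e; exact: FP.
pose c := shift_coef n r (h a) (h b).
have -> : (fun x => dilate m (x + h a) r - dilate m (x + h b) r) =
    fun x => \sum_(l <- L) single l.1 (c l * x ^+ l.2) + single i0 (c (i0, 1%N) * x).
  apply: funext => x.
  transitivity (\sum_(i in supp) single i (((x + h a) ^+ n i - (x + h b) ^+ n i) * r i)).
    rewrite [LHS]vec_decomposition [LHS](bigID (mem supp)) /=.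
    rewrite [X in _ + X]big1 ?addr0 => [|i].
      by apply: eq_bigr => i ri; rewrite !ffunE nE // -!exprnP mulrBl.
    rewrite inE negbK => /eqP ri; rewrite !ffunE ri !mulr0 subr0.
    by apply/ffunP => j; rewrite !ffunE; case: ifP.
  rewrite (shift_difference _ _ _ _ nM) -/Lf -/c (bigD1_seq (i0, 1%N)) //= addrC.
  by rewrite -big_filter expr1.
apply: add_monomials_sum; exists (c (i0, 1%N)); split => //.
rewrite /c /shift_coef /= bin1 mulf_neq0 // -mulr_natr mulf_neq0 //.
  by rewrite subn1 subr_eq0.
by rewrite nE // in nK0.
Qed.
End one_sided_weights.

(** * Weights of both signs *)

Section poles.
Variables (K : fieldType).
Hypothesis infK : forall B : seq K, exists x, x \notin B.

(** A rational function with a pole p other than 0; a pole is moved by the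
scalings of the argument that occur in a twist but cannot be cancelled, and a
function with a pole has only finitely many zeros. *)
Definition has_pole (f : K -> K) := exists (N D : {poly K}) (p : K),
  [/\ p != 0, D != 0, root D p, ~~ root N p &
      forall x, ~~ root D x -> f x = N.[x] / D.[x]].

Lemma has_pole_nonzero f : has_pole f ->
  exists s : seq K, forall x, x \notin s -> f x != 0.
Proof.
move=> [N [D [p [p0 D0 Dp Np fE]]]].
have N0 : N != 0 by apply: contraNneq Np => ->; rewrite root0.
have [s sP] := poly_roots_seq (mulf_neq0 N0 D0).
exists s => x; apply: contra => /eqP fx; apply: sP; rewrite rootM.
apply/orP; have [Dx|Dx] := boolP (root D x); [by right|left].
move: fx; rewrite fE // => /eqP; rewrite mulf_eq0 invr_eq0 orbC.
by case/predU1P => [/rootP|//]; rewrite (negPf Dx).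
Qed.

(** At p / a ^ n the first summand has a pole, and for generic b / a the second one
has none. *)
Lemma has_pole_twist f n : (0 < n)%N -> has_pole f ->
  exists B : seq K, forall a b c d, a != 0 -> b != 0 -> c != 0 ->
    b / a \notin B -> has_pole (fun x => c * f (a ^+ n * x) - d * f (b ^+ n * x)).
Proof.
move=> n0 [N [D [p [p0 D0 Dp Np fE]]]].
have [|B BP] := @poly_roots_seq _ (D \Po (p *: 'X^n)).
  by rewrite comp_poly_eq0 // size_scale // size_polyXn.
exists B => a b c d a0 b0 c0 ab.
pose Dil (P : {poly K}) e := P \Po (e ^+ n *: 'X).
have DilE P e x : (Dil P e).[x] = P.[e ^+ n * x].
  by rewrite horner_comp hornerZ hornerX.
have Dil0 e : e != 0 -> Dil D e != 0.
  by move=> e0; rewrite comp_poly_eq0 // size_scale ?expf_neq0 // size_polyX.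
have apn : a ^+ n * (p / a ^+ n) = p by rewrite mulrC divfK // expf_neq0.
have Dbp : D.[b ^+ n * (p / a ^+ n)] != 0.
  apply: contra ab => Dab; apply: BP; rewrite rootE horner_comp hornerZ hornerXn.
  by rewrite expr_div_n mulrCA.
exists (c *: (Dil N a * Dil D b) - d *: (Dil N b * Dil D a)), (Dil D a * Dil D b),
  (p / a ^+ n); split.
- by rewrite mulf_neq0 // invr_eq0 expf_neq0.
- by rewrite mulf_neq0 ?Dil0.
- by rewrite rootM; apply/orP; left; rewrite rootE DilE apn.
- rewrite rootE hornerD hornerN !hornerZ !hornerM !DilE apn (rootP Dp).
  rewrite !mulr0 subr0.
  by rewrite !mulf_neq0.
move=> x; rewrite rootM negb_or !rootE !DilE => /andP[Da Db].
rewrite hornerD hornerN !hornerZ !hornerM !DilE !fE //; field.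
by rewrite Da Db.
Qed.

Lemma has_pole_shift (n : nat) (r h h' : K) : (0 < n)%N -> r != 0 -> h != 0 ->
  h != h' -> has_pole (fun x => ((x + h) ^- n - (x + h') ^- n) * r).
Proof.
move=> n0 r0 h0 hh'.
exists (r *: (('X + h'%:P) ^+ n - ('X + h%:P) ^+ n)),
  (('X + h%:P) ^+ n * ('X + h'%:P) ^+ n), (- h); split.
- by rewrite oppr_eq0.
- by rewrite mulf_neq0 // expf_neq0 // -size_poly_eq0 size_XaddC.
- by rewrite rootE hornerM horner_exp hornerD hornerX hornerC addNr expr0n eqn0Ngt n0 mul0r.
- rewrite rootE hornerZ hornerD hornerN !horner_exp !hornerD hornerX !hornerC.
  rewrite addNr expr0n eqn0Ngt n0 subr0 mulf_neq0 // expf_neq0 //.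
  by rewrite addrC subr_eq0 eq_sym.
move=> x; rewrite rootE hornerZ hornerM hornerD hornerN !horner_exp !hornerD hornerX !hornerC.
rewrite mulf_eq0 negb_or => /andP[xh xh'].
by field; rewrite xh xh'.
Qed.
End poles.

Section all_weights.
Variables (R : archiRealFieldType) (K : fieldType) (I : finType).
Notation vec := {ffun I -> K}.
Hypothesis infK : forall B : seq K, exists x, x \notin B.
Variables (m : I -> int) (C S : vec -> R).
Hypothesis C0 : C 0 = 1.
Hypothesis Cpos : square_dominated C C.
Hypothesis Cinv : dilation_invariant m C.
Hypothesis Spos : square_dominated S C.
Hypothesis Sinv : dilation_invariant m S.
Hypothesis m_inj : injective m.

(** The remainder for weights of both signs: it lives on the coordinates P of the
negative weights, and its coordinate i is a rational function with a pole. *)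
Definition pole_class (P : {pred I}) (i : I) (q : K -> vec) :=
  (forall x j, j \notin P -> q x j = 0) /\ has_pole (fun x => q x i).

Lemma pole_class_stable P i1 i n : 0 < m i -> twist_stable m i n (pole_class P i1).
Proof.
move=> mi q [qP qpole].
have [|B BP] := @has_pole_twist _ _ `|m i|%N _ qpole; first by rewrite absz_gt0 gt_eqF.
have mE y : y ^ m i = y ^+ `|m i| :> K by rewrite exprnP gez0_abs // ltW.
exists B => a b a0 b0 ab; split=> [x j jP|].
  by rewrite !ffunE !qP // !mulr0 subr0.
have := BP a b ((a ^- n) ^ m i1) ((b ^- n) ^ m i1) a0 b0 _ ab.
rewrite expfz_neq0 ?invr_eq0 ?expf_neq0 // => /(_ isT).
by under eq_fun do rewrite -!mE;
  under [X in _ -> has_pole X]eq_fun do rewrite !ffunE.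
Qed.

(** One point x outside the zeros is a sufficient sample, because C vanishes at the
nonzero vectors supported by P. *)
Lemma pole_class_small P i1 : i1 \in P ->
  (forall r : vec, r != 0 -> (forall j, j \notin P -> r j = 0) -> C r = 0) ->
  small_averages C (pole_class P i1).
Proof.
move=> i1P CP J q B e qP e0.
have /choice[s sP] : forall j, exists s : seq K, forall x, x \notin s -> q j x i1 != 0.
  by move=> j; apply: has_pole_nonzero; case: (qP j).
have [x] := infK (B ++ flatten [seq s j | j <- enum J]).
rewrite mem_cat negb_or => /andP[xB xs].
exists [:: x]; split => // [y|j]; first by rewrite inE => /eqP ->.
rewrite big_seq1 mulr1 CP; [exact: ltW| |by case: (qP j) => qj _; exact: qj].
suff : q j x i1 != 0 by apply: contraNneq => ->; rewrite ffunE.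
apply: sP; apply: contra xs => xs; apply/flattenP; exists (s j) => //.
by apply: map_f; rewrite mem_enum.
Qed.

(** In the difference of two shifts the coordinates of the positive weights are
polynomials in x, all monomials of which can be eliminated. The coordinates of the
negative weights are rational functions; they keep a pole, hence are nonzero for
almost all x, where C is known to vanish. *)
Lemma mixed_weights_vanish (r : vec) i1 : r i1 != 0 -> m i1 < 0 ->
  (forall i, m i != 0) ->
  (forall r' : vec, r' != 0 ->
     (forall j, ~~ ((r j != 0) && (m j < 0)) -> r' j = 0) -> C r' = 0) ->
  S r = 0.
Proof.
move=> ri1 mi1 m0 Cneg.
pose n i := `|m i|%N.
pose pos : {pred I} := [pred i | 0 < m i].
pose neg : {pred I} := [pred i | (r i != 0) && (m i < 0)].
pose M := (\max_i n i).+1.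
have nM i : i \in pos -> (n i < M)%N by move=> _; rewrite ltnS; exact: leq_bigmax.
pose L := [seq (i, k) | i <- enum pos, k <- index_iota 0 M].
have Lpos l : l \in L -> 0 < m l.1.
  by move=> /allpairsP[[i k] /= [+ _ ->]]; rewrite mem_enum.
apply: (vanishing_from_shifts C0 Spos Sinv (r := r)
          (G := add_monomials L (pole_class neg i1))); last first.
  apply: (eliminate_monomials infK C0 Cpos Cinv).
  - by move=> l /Lpos; rewrite lt0r => /andP[].
  - by move=> l /Lpos; exact: pole_class_stable.
  - by apply: pole_class_small => //; rewrite inE ri1.
move=> N; have [h [h0 hF]] := greedy_choice infK (fun y => [:: y]) [:: 0] N.
exists h => a b ab.
have hab : h a != h b.
  by move: ab; rewrite neq_ltn => /orP[] /hF; rewrite inE // eq_sym.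
have -> : (fun x => dilate m (x + h a) r - dilate m (x + h b) r) =
    fun x => \sum_(l <- L) single l.1 (shift_coef n r (h a) (h b) l * x ^+ l.2) +
      \sum_(i | m i < 0) single i (((x + h a) ^ m i - (x + h b) ^ m i) * r i).
  apply: funext => x; rewrite -(shift_difference _ _ _ _ nM).
  rewrite [LHS]vec_decomposition [LHS](bigID (mem pos)) /=; congr (_ + _).
    by apply: eq_bigr => i mi; rewrite !ffunE mulrBl !exprnP !gez0_abs // ltW.
  apply: eq_big => [i|i _]; last by rewrite !ffunE mulrBl.
  by rewrite inE -leNgt le_eqVlt (negPf (m0 i)).
apply: add_monomials_sum.
have negE x j : (\sum_(i | m i < 0) single i (((x + h a) ^ m i - (x + h b) ^ m i) * r i)) j =
    if m j < 0 then ((x + h a) ^ m j - (x + h b) ^ m j) * r j else 0.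
  rewrite sum_ffunE; under eq_bigr do rewrite ffunE.
  have [mj|mj] := ifPn; last first.
    by rewrite big1 // => i mi; case: eqP => // ji; rewrite ji mi in mj.
  rewrite (bigD1 j) //= eqxx big1 ?addr0 // => i /andP[_ ij].
  by rewrite eq_sym (negPf ij).
split=> [x j|].
  rewrite negE inE negb_and negbK => /orP[/eqP ->|/negPf -> //].
  by rewrite mulr0 if_same.
under eq_fun do rewrite negE mi1.
have mE y : y ^ m i1 = y ^- n i1 :> K.
  by rewrite exprnN /n ltz0_abs // opprK.
under eq_fun do rewrite !mE.
apply: has_pole_shift => //; first by rewrite absz_gt0.
by have := h0 a; rewrite inE.
Qed.
End all_weights.

Section vanishing.
Variables (R : archiRealFieldType) (K : fieldType) (I : finType).
Notation vec := {ffun I -> K}.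
Hypothesis infK : forall B : seq K, exists x, x \notin B.
Variable C : vec -> R.
Hypothesis C0 : C 0 = 1.
Hypothesis Cpos : square_dominated C C.

(** If all weights are negative, the substitution of 1 / a for a makes them
positive. *)
Lemma large_weights_vanish (m : I -> int) (S : vec -> R) (r : vec) :
  dilation_invariant m C -> square_dominated S C -> dilation_invariant m S ->
  injective m -> (forall i, 1 < `|m i|) -> r != 0 ->
  (forall i, r i != 0 -> (m i)%:~R != 0 :> K /\ small_averages C (line i)) ->
  S r = 0.
Proof.
move=> Cinv Spos Sinv m_inj m1 r0 rP.
have neg (S' : vec -> R) (r' : vec) : square_dominated S' C -> dilation_invariant m S' -> r' != 0 ->
    (forall j, ~~ ((r j != 0) && (m j < 0)) -> r' j = 0) -> S' r' = 0.
  move=> S'pos S'inv r'0 r'P.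
  pose m' i := - m i.
  have dilE a x : dilate m' a x = dilate m a^-1 x :> vec.
    by apply/ffunP => i; rewrite !ffunE exprz_inv.
  have inv (f : vec -> R) : dilation_invariant m f -> dilation_invariant m' f.
    by move=> finv a x a0; rewrite dilE finv // invr_eq0.
  apply: (positive_weights_vanish infK (m := m') (C := C)) => //.
  - exact: inv.
  - exact: inv.
  - by move=> i j /oppr_inj /m_inj.
  move=> i r'i; have : (r i != 0) && (m i < 0).
    by apply: contraNT r'i => ri; rewrite r'P.
  move=> /andP[ri mi]; have [mK sm] := rP _ ri; split => //.
    by rewrite /m' -(ltr0_norm mi).
  by rewrite /m' rmorphN oppr_eq0.
have m0 i : m i != 0 by rewrite -normr_gt0 (lt_trans _ (m1 i)).
have [[i1 [ri1 mi1]]|allpos] := pselect (exists i, r i != 0 /\ m i < 0).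
  apply: (mixed_weights_vanish infK (m := m) C0 Cpos Cinv Spos Sinv ri1 mi1 m0).
  by move=> r' r'0 r'P; apply: neg.
apply: (positive_weights_vanish infK (m := m) (C := C)) => // i ri.
have [mK sm] := rP _ ri; split => //.
rewrite -(@ger0_norm _ (m i)) // leNgt; apply/negP => mi.
by apply: allpos; exists i.
Qed.

(** Restricting the action to the k-th powers multiplies the weights by k, which
makes them larger than 1 in absolute value. One of 2 and 3 is nonzero in K. *)
Lemma weights_vanish (m : I -> int) (S : vec -> R) (r : vec) :
  dilation_invariant m C -> square_dominated S C -> dilation_invariant m S ->
  injective m -> (forall i, m i != 0) -> r != 0 ->
  (forall i, r i != 0 -> (m i)%:~R != 0 :> K /\ small_averages C (line i)) ->
  S r = 0.
Proof.
move=> Cinv Spos Sinv m_inj m0 r0 rP.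
have [k k1 kK] : exists2 k : nat, (1 < k)%N & k%:R != 0 :> K.
  have [K2|K2] := eqVneq (2%:R : K) 0; last by exists 2%N.
  by exists 3%N => //; rewrite (natrD _ 1 2) K2 addr0 oner_neq0.
pose m' i := k%:Z * m i.
have dilE a x : dilate m' a x = dilate m (a ^+ k) x :> vec.
  by apply/ffunP => i; rewrite !ffunE -exprz_exp -exprnP.
have inv (f : vec -> R) : dilation_invariant m f -> dilation_invariant m' f.
  by move=> finv a x a0; rewrite dilE finv // expf_neq0.
apply: (large_weights_vanish (m := m')) => //.
- exact: inv.
- exact: inv.
- by move=> i j /mulfI /m_inj; apply; rewrite -lt0n ltnW.
- move=> i; rewrite normrM (lt_le_trans (y := `|k%:Z|)) //.
  by rewrite ler_peMr // -gtz0_ge1 normr_gt0.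
move=> i /rP[mK sm]; split => //.
by rewrite rmorphM /= mulf_neq0.
Qed.
End vanishing.

(** * Integrals of bounded functions *)

Section bounded_integrals.
Context d (T : measurableType d) (R : realType) (P : probability T R).
Implicit Types f g : T -> R.

Definition bounded_measurable f :=
  measurable_fun setT f /\ exists M, forall x, `|f x| <= M.

Lemma bounded_measurable_cst (a : R) : bounded_measurable (cst a).
Proof. by split; [exact: measurable_cst | exists `|a|]. Qed.

Lemma bounded_measurable_lin a f g : bounded_measurable f ->
  bounded_measurable g -> bounded_measurable (fun x => a * f x + g x).
Proof.
move=> [mf [M fM]] [mg [N gN]]; split.
  by apply: measurable_funD => //; apply: measurable_funM => //; exact: measurable_cst.
exists (`|a| * M + N) => x; rewrite (le_trans (ler_normD _ _)) // lerD //.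
by rewrite normrM ler_wpM2l.
Qed.

Lemma bounded_measurableM f g : bounded_measurable f ->
  bounded_measurable g -> bounded_measurable (fun x => f x * g x).
Proof.
move=> [mf [M fM]] [mg [N gN]]; split; first exact: measurable_funM.
by exists (M * N) => x; rewrite normrM ler_pM.
Qed.

Lemma bounded_measurableD f g : bounded_measurable f ->
  bounded_measurable g -> bounded_measurable (fun x => f x + g x).
Proof.
move=> bf bg; have := bounded_measurable_lin 1 bf bg.
by under eq_fun do rewrite mul1r.
Qed.

Lemma bounded_measurableZ a f : bounded_measurable f ->
  bounded_measurable (fun x => a * f x).
Proof. by move=> bf; apply: bounded_measurableM => //; exact: bounded_measurable_cst. Qed.

Lemma bounded_measurable_sum (I : Type) (r : seq I) (F : I -> T -> R) :
  (forall i, bounded_measurable (F i)) ->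
  bounded_measurable (fun x => \sum_(i <- r) F i x).
Proof.
move=> bF; elim: r => [|i r IH].
  by under eq_fun do rewrite big_nil; exact: bounded_measurable_cst.
by under eq_fun do rewrite big_cons; exact: bounded_measurableD.
Qed.

Lemma bounded_measurable_indic (A : set T) : measurable A ->
  bounded_measurable \1_A.
Proof.
move=> mA; split; first exact: measurable_indic.
by exists 1 => x; rewrite indicE; case: (_ \in _); rewrite ?normr1 ?normr0.
Qed.

Lemma bounded_measurable_integrable f : bounded_measurable f ->
  P.-integrable setT (EFin \o f).
Proof.
move=> [mf [M fM]]; apply: measurable_bounded_integrable => //.
  by apply: le_lt_trans (probability_le1 P measurableT) _; rewrite ltry.
by exists M; split; [exact: num_real | move=> N MN x _; exact: le_trans (fM x) (ltW MN)].
Qed.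

Lemma integral_lin a f g : bounded_measurable f -> bounded_measurable g ->
  \int[P]_x (a * f x + g x) = a * \int[P]_x f x + \int[P]_x g x.
Proof.
move=> bf bg; rewrite RintegralD //; try exact: bounded_measurable_integrable.
  by rewrite RintegralZl //; exact: bounded_measurable_integrable.
by apply: bounded_measurable_integrable; exact: bounded_measurableZ.
Qed.

Lemma integral_cst_prob (a : R) : \int[P]_x a = a.
Proof.
rewrite Rintegral_cst //; have /= -> := probability_setT P; exact: mulr1.
Qed.

Lemma integral_indic_prob (A : set T) : measurable A -> \int[P]_x \1_A x = fine (P A).
Proof. by move=> mA; rewrite /Rintegral integral_indic // setIT. Qed.

Lemma integral_scale a f : bounded_measurable f ->
  \int[P]_x (a * f x) = a * \int[P]_x f x.
Proof. by move=> bf; rewrite RintegralZl //; exact: bounded_measurable_integrable. Qed.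

Lemma integral_add f g : bounded_measurable f -> bounded_measurable g ->
  \int[P]_x (f x + g x) = \int[P]_x f x + \int[P]_x g x.
Proof. by move=> bf bg; rewrite RintegralD //; exact: bounded_measurable_integrable. Qed.

Lemma integral_sum (I : Type) (r : seq I) (F : I -> T -> R) :
  (forall i, bounded_measurable (F i)) ->
  \int[P]_x (\sum_(i <- r) F i x) = \sum_(i <- r) \int[P]_x F i x.
Proof.
move=> bF; elim: r => [|i r IH].
  by rewrite big_nil; under eq_Rintegral do rewrite big_nil; rewrite integral_cst_prob.
rewrite big_cons -IH -integral_add //; last exact: bounded_measurable_sum.
by under eq_Rintegral do rewrite big_cons.
Qed.

Lemma integral_le f g : bounded_measurable f -> bounded_measurable g ->
  (forall x, f x <= g x) -> \int[P]_x f x <= \int[P]_x g x.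
Proof.
by move=> bf bg fg; apply: le_Rintegral => //; exact: bounded_measurable_integrable.
Qed.

(** The variance is nonnegative. *)
Lemma integral_square_ge f : bounded_measurable f ->
  (\int[P]_x f x) ^+ 2 <= \int[P]_x (f x ^+ 2).
Proof.
move=> bf; set c := \int[P]_x f x.
have bf2 : bounded_measurable (fun x => f x ^+ 2).
  by under eq_fun do rewrite expr2; exact: bounded_measurableM.
have : 0 <= \int[P]_x ((- (2 * c)) * f x + (f x ^+ 2 + c ^+ 2)).
  by apply: Rintegral_ge0 => x _; have := sqr_ge0 (f x - c); lra.
rewrite integral_lin //; last first.
  by apply: bounded_measurableD => //; exact: bounded_measurable_cst.
rewrite integral_add //; last exact: bounded_measurable_cst.
by rewrite integral_cst_prob -/c; lra.
Qed.

Lemma integral_bounded_cvg (F : nat -> T -> R) f M :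
  (forall n, measurable_fun setT (F n)) -> (forall n x, `|F n x| <= M) ->
  {ae P, forall x, F ^~ x @ \oo --> f x} -> bounded_measurable f ->
  \int[P]_x F n x @[n --> \oo] --> \int[P]_x f x.
Proof.
move=> mF FM Ff bf; apply: fine_cvg; rewrite fineK; last first.
  by apply: integrable_fin_num => //; exact: bounded_measurable_integrable.
have [] := @dominated_convergence _ T R P setT measurableT
  (fun n => EFin \o F n) (EFin \o f) (cst M%:E).
- by move=> n; apply/measurable_EFinP.
- by apply/measurable_EFinP; case: bf.
- by apply: filterS Ff => x Fx _; apply/fine_cvgP; split; [exact: nearW | exact: Fx].
- exact: (bounded_measurable_integrable (bounded_measurable_cst M)).
- by apply: aeW => x n _ /=; rewrite lee_fin.
by move=> _ _; apply.
Qed.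
End bounded_integrals.

(** * Characters and the Borel sets of the dual *)

Section characters.
Variables (R : realType) (V : zmodType).
Implicit Types (xi : pdual R V) (u v : V).

Definition re v xi : R := complex.Re (xi v).
Definition im v xi : R := complex.Im (xi v).

Lemma reD u v xi : re (u + v) xi = re u xi * re v xi - im u xi * im v xi.
Proof.
have [_ xiD] := pdual_funP xi; rewrite /re /im xiD.
by case: (xi u) => a b; case: (xi v) => c d.
Qed.

Lemma imD u v xi : im (u + v) xi = re u xi * im v xi + im u xi * re v xi.
Proof.
have [_ xiD] := pdual_funP xi; rewrite /re /im xiD.
by case: (xi u) => a b; case: (xi v) => c d.
Qed.

Lemma re2Dim2 v xi : re v xi ^+ 2 + im v xi ^+ 2 = 1.
Proof.
have [xi1 _] := pdual_funP xi.
have : ((re v xi ^+ 2 + im v xi ^+ 2)%:C)%C = 1 by rewrite add_Re2_Im2 xi1 expr1n.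
by case.
Qed.

Lemma char0 xi : xi 0 = 1.
Proof.
have [xi1 xiD] := pdual_funP xi; have xi0 : xi 0 != 0.
  by rewrite -normr_eq0 xi1 oner_neq0.
by apply: (mulfI xi0); rewrite -xiD addr0 mulr1.
Qed.

Lemma re0 xi : re 0 xi = 1. Proof. by rewrite /re char0. Qed.
Lemma im0 xi : im 0 xi = 0. Proof. by rewrite /im char0. Qed.

Lemma re_im_oppr v xi : re (- v) xi = re v xi /\ im (- v) xi = - im v xi.
Proof.
have := reD (- v) v xi; have := imD (- v) v xi; rewrite addNr re0 im0.
move: (re2Dim2 v xi); move: (re (- v) _) (im (- v) _) (re v _) (im v _).
move=> a b c d h1 h2 h3; split; apply/eqP; rewrite -subr_eq0 ?opprK; apply/eqP.
  have -> : a - c = a * (1 - (c ^+ 2 + d ^+ 2)) + c * (a * c - b * d - 1) +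
    d * (a * d + b * c) by ring.
  by rewrite h1 -h2 -h3 !subrr !mulr0 !addr0.
have -> : b + d = b * (1 - (c ^+ 2 + d ^+ 2)) - d * (a * c - b * d - 1) +
  c * (a * d + b * c) by ring.
by rewrite h1 -h2 -h3 !subrr !mulr0 subr0 addr0.
Qed.

Lemma reN v xi : re (- v) xi = re v xi. Proof. by case: (re_im_oppr v xi). Qed.
Lemma imN v xi : im (- v) xi = - im v xi. Proof. by case: (re_im_oppr v xi). Qed.

Lemma re_bound v xi : `|re v xi| <= 1.
Proof. by rewrite ler_norml; have := re2Dim2 v xi; have := sqr_ge0 (im v xi); nra. Qed.

Lemma im_bound v xi : `|im v xi| <= 1.
Proof. by rewrite ler_norml; have := re2Dim2 v xi; have := sqr_ge0 (re v xi); nra. Qed.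

Lemma char_eq1 v xi : xi v = 1 <-> re v xi = 1.
Proof.
split=> [|re1]; first by rewrite /re => ->.
have := re2Dim2 v xi; rewrite re1 expr1n => /(canRL (addKr _)); rewrite addNr => /eqP.
rewrite sqrf_eq0 => /eqP im1; apply/eqP; rewrite eq_complex; apply/andP; split; apply/eqP.
  exact: re1.
exact: im1.
Qed.

Lemma eval_continuous v : continuous (fun xi : pdual R V => xi v : R[i]^o).
Proof.
move=> xi; apply: (@continuous_comp _ _ _ (fun x : pdual R V => val x)
  (fun g : {ptws V -> R[i]^o} => g v)).
  exact: initial_continuous.
exact: (@proj_continuous V (fun=> R[i]^o) v).
Qed.
End characters.

Section borel_generation.
Variables (R : realType) (V : zmodType).
Implicit Types (xi : pdual R V) (u v : V).

Lemma Re_continuous : continuous (fun z : R[i]^o => complex.Re z : R^o).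
Proof.
move=> z A /(@nbhs_ballP _ R^o)[e /= e0 eA].
have e0' : 0 < (e%:C)%C by rewrite ltcR.
apply/(@nbhs_ballP _ R[i]^o); exists (e%:C)%C => //= w; rewrite -ball_normE /= => zw.
apply: eA; rewrite -ball_normE /=.
have := le_lt_trans (normc_ge_Re (z - w)) zw; rewrite ltcR.
by case: (z) => a b; case: (w).
Qed.

Lemma Im_continuous : continuous (fun z : R[i]^o => complex.Im z : R^o).
Proof.
move=> z A /(@nbhs_ballP _ R^o)[e /= e0 eA].
have e0' : 0 < (e%:C)%C by rewrite ltcR.
apply/(@nbhs_ballP _ R[i]^o); exists (e%:C)%C => //= w; rewrite -ball_normE /= => zw.
apply: eA; rewrite -ball_normE /=.
have := normc_ge_Re ((z - w) * 'i%C); rewrite ReiNIm normrM.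
rewrite [X in _ * X]normc_def /= expr0n expr1n add0r sqrtr1 mulr1 normrN.
move=> /le_lt_trans /(_ zw); rewrite ltcR.
by case: (z) => a b; case: (w).
Qed.

Lemma continuous_measurable_borel (f : pdual R V -> R) :
  continuous (f : pdual R V -> R^o) ->
  measurable_fun setT (f : borel (pdual R V) -> R).
Proof.
move=> cf; apply: (measurability _ (RGenOInfty.measurableE R)) => //.
move=> _ [_ [x ->] <-]; rewrite setTI; apply: sub_sigma_algebra.
by move/continuousP : cf; apply; exact: rray_open.
Qed.

Lemma re_continuous v : continuous (re v : pdual R V -> R^o).
Proof.
by move=> xi; apply: continuous_comp; [exact: eval_continuous|exact: Re_continuous].
Qed.

Lemma im_continuous v : continuous (im v : pdual R V -> R^o).
Proof.
by move=> xi; apply: continuous_comp; [exact: eval_continuous|exact: Im_continuous].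
Qed.

Lemma bounded_measurable_re v : bounded_measurable (re v : borel (pdual R V) -> R).
Proof.
split; first exact: continuous_measurable_borel (@re_continuous v).
by exists 1 => xi; exact: re_bound.
Qed.

Lemma bounded_measurable_im v : bounded_measurable (im v : borel (pdual R V) -> R).
Proof.
split; first exact: continuous_measurable_borel (@im_continuous v).
by exists 1 => xi; exact: im_bound.
Qed.
Lemma measurable_char_eq1 v :
  measurable ([set xi : pdual R V | xi v = 1] : set (borel (pdual R V))).
Proof.
have [mre _] := bounded_measurable_re v.
have := mre measurableT [set 1] (measurable_set1 _); rewrite setTI.
by congr measurable; apply/seteqP; split=> xi /= /char_eq1.
Qed.

End borel_generation.

Section cylinders.
Variables (R : realType) (V : zmodType) (en : nat -> V).
Hypothesis en_surj : forall v, exists n, en n = v.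

Definition coordinate (b : bool) (g : V -> R[i]) (v : V) : R :=
  if b then complex.Re (g v) else complex.Im (g v).

(** The index consists of a sign, the choice between real and imaginary part, the
number of a point of V and a rational bound. *)
Definition half_space (h : bool * bool * nat * rat) (g : V -> R[i]) : Prop :=
  (-1) ^+ h.1.1.1 * coordinate h.1.1.2 g (en h.1.2) < ratr h.2.

(** Finite intersections of half spaces with rational bounds, at points given by an
enumeration of V, are countable in number and stable under intersection. *)
Definition cylinder (l : seq (bool * bool * nat * rat)) (g : V -> R[i]) : Prop :=
  forall h, h \in l -> half_space h g.

Lemma cylinder_cat l l' g : cylinder (l ++ l') g <-> cylinder l g /\ cylinder l' g.
Proof.
split=> [ll|[hl hl'] h]; last by rewrite mem_cat => /orP[/hl|/hl'].
by split=> h hl; apply: ll; rewrite mem_cat hl ?orbT.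
Qed.

Definition cylinder_nbhs (f : V -> R[i]) : set_system (V -> R[i]) :=
  [set A | exists l, cylinder l f /\ forall g, cylinder l g -> A g].

Lemma cylinder_nbhs_filter f : Filter (cylinder_nbhs f).
Proof.
split=> [|P Q [l [lf lP]] [l' [lf' lQ]]|P Q PQ [l [lf lP]]].
- by exists [::].
- exists (l ++ l'); split; first exact/cylinder_cat.
  by move=> g /cylinder_cat[/lP ? /lQ].
- by exists l; split=> // g /lP /PQ.
Qed.

Lemma norm_lt_re_im (z e : R[i]) : `|complex.Re z| < complex.Re e / 2 ->
  `|complex.Im z| < complex.Re e / 2 -> 0 < e -> `|z| < e.
Proof.
move=> zr zi; case: e zr zi => e e' /= zr zi; rewrite ltcE /= => /andP[/eqP -> e0].
rewrite normc_def ltcR -[ltRHS]ger0_norm ?(ltW e0) // -sqrtr_sqr.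
rewrite ltr_sqrt ?exprn_gt0 //.
rewrite -[_ ^+ 2]real_normK ?num_real // -[complex.Im z ^+ 2]real_normK ?num_real //.
by move: (normr_ge0 (complex.Re z)) (normr_ge0 (complex.Im z)); nra.
Qed.

(** Through the criterion for pointwise convergence this says that the cylinders
around f are a basis of its neighbourhoods. *)
Lemma cylinder_nbhs_cvg (f : V -> R[i]) :
  {ptws, cylinder_nbhs f --> (f : V -> R[i]^o)}.
Proof.
have FF := cylinder_nbhs_filter f.
apply/(@pointwise_cvgP (discrete_topology V) R[i]^o (cylinder_nbhs f) f FF).
move=> v A /(@nbhs_ballP _ R[i]^o)[e /= e0 eA].
have [n nv] := en_surj v.
have d0 : 0 < complex.Re e / 2.
  by rewrite divr_gt0 //; move: e0; rewrite ltcE => /andP[].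
have q (s b : bool) : {q : rat | (-1) ^+ s * coordinate b f v < ratr q <
    (-1) ^+ s * coordinate b f v + complex.Re e / 2 }.
  apply: cid; have [|q] := @rat_in_itvoo R ((-1) ^+ s * coordinate b f v)
    ((-1) ^+ s * coordinate b f v + complex.Re e / 2); first by rewrite ltrDl.
  by rewrite in_itv /=; exists q.
exists [seq (s, b, n, sval (q s b)) | s <- [:: false; true], b <- [:: false; true]].
split=> [h /allpairsP[[s b] /= [_ _ ->]]|g gl].
  by rewrite /half_space /= nv; case: (q s b) => ? /= /andP[].
apply: eA; rewrite -ball_normE /=.
have gb (s b : bool) : (-1) ^+ s * (coordinate b g v - coordinate b f v) < complex.Re e / 2.
  have : half_space (s, b, n, sval (q s b)) g.
    apply: gl; apply/allpairsP; exists (s, b); split => //=.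
      by case: s.
    by case: b.
  rewrite /half_space /= nv; case: (q s b) => ? /= /andP[_ q2] q1.
  by rewrite mulrBr ltrBlDl; exact: lt_trans q1 q2.
have gn b : `|coordinate b f v - coordinate b g v| < complex.Re e / 2.
  rewrite distrC ltr_norml; have := gb false b; have := gb true b.
  by rewrite expr1 expr0 mulN1r mul1r ltrNl => -> ->.
apply: norm_lt_re_im => //.
  by have := gn true; rewrite /coordinate; case: (f v) => ? ?; case: (g v).
by have := gn false; rewrite /coordinate; case: (f v) => ? ?; case: (g v).
Qed.

Lemma open_cylinder (O : set (pdual R V)) xi : open O -> O xi ->
  exists l, cylinder l xi /\ forall eta : pdual R V, cylinder l eta -> O eta.
Proof.
case=> O' oO' <- O'xi.
have [l [lxi lO]] := @cylinder_nbhs_cvg (val xi) O' (open_nbhs_nbhs (conj oO' O'xi)).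
by exists l; split => // eta /lO.
Qed.

Definition cylinder_set l : set (pdual R V) := [set xi : pdual R V | cylinder l xi].

(** As there are only countably many cylinders, every open set is a countable union
of them, so they generate the Borel sets; the pi-lambda theorem applies. *)
Lemma borel_cylinder_induction (D : set (set (pdual R V))) : dynkin D ->
  (forall l, D (cylinder_set l)) ->
  forall A : set (borel (pdual R V)), measurable A -> D A.
Proof.
move=> dD Dc A mA.
pose G := range cylinder_set.
have GI : setI_closed G.
  move=> _ _ [l _ <-] [l' _ <-]; exists (l ++ l') => //.
  by apply/seteqP; split=> xi /=; rewrite /cylinder_set /= => /cylinder_cat.
have : <<d G >> A.
  rewrite (setI_closed_g_dynkin_g_sigma_algebra GI).
  have : <<s @open (pdual R V) >> A by [].
  apply: smallest_sub; first exact: smallest_sigma_algebra.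
  move=> O oO.
  pose F (o : option (seq (bool * bool * nat * rat))) := if o is Some l then
    [set xi | cylinder_set l xi /\ cylinder_set l `<=` O] else set0.
  have -> : O = \bigcup_n F (unpickle n).
    apply/seteqP; split=> [xi Oxi|xi [n _]]; last first.
      by case: (unpickle n : option _) => // l [lx]; apply.
    have [l [lxi lO]] := open_cylinder oO Oxi.
    by exists (pickle l) => //; rewrite pickleK.
  have [s0 _ bigU] := smallest_sigma_algebra setT G; apply: bigU => n.
  move: (unpickle n : option _) => [l|]; last exact: s0.
  rewrite /F.
  have [lO|lO] := pselect (cylinder_set l `<=` O).
    apply: sub_sigma_algebra; exists l => //.
    by apply/seteqP; split=> xi //= [].
  rewrite (_ : [set _ | _] = set0); first exact: s0.
  by apply/seteqP; split=> xi //= [].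
by apply; split=> // _ [l _ <-].
Qed.
End cylinders.

(** * A measure is determined by its Fourier coefficients *)

Section step_polynomials.
Variable R : realType.
Implicit Types (y w a : R) (n : nat).

Lemma bernoulli_lower a n : 0 <= a <= 1 -> 1 - n%:R * a <= (1 - a) ^+ n.
Proof.
move=> /andP[a0 a1]; elim: n => [|n IH]; first by rewrite mul0r subr0 expr0.
rewrite exprS -natr1; apply: le_trans (ler_wpM2l _ IH); last by rewrite subr_ge0.
have : 0 <= n%:R * a ^+ 2 by rewrite mulr_ge0 // exprn_ge0.
by move: (n%:R : R) => n'; lra.
Qed.

Lemma bernoulli_upper a n : 0 <= a <= 1 -> (1 - a) ^+ n * (1 + n%:R * a) <= 1.
Proof.
move=> a01; have /andP[a0 a1] := a01.
apply: (@le_trans _ _ ((1 - a) ^+ n * (1 + a) ^+ n)).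
  rewrite ler_wpM2l ?exprn_ge0 ?subr_ge0 //.
  elim: n => [|n IH]; first by rewrite mul0r addr0 expr0.
  rewrite exprS -natr1; apply: le_trans (ler_wpM2l _ IH); last by rewrite addr_ge0.
  have : 0 <= n%:R * a ^+ 2 by rewrite mulr_ge0 // exprn_ge0.
  by move: (n%:R : R) => n'; lra.
rewrite -exprMn exprn_ile1 //; last by nra.
by rewrite mulr_ge0 ?subr_ge0 // addr_ge0.
Qed.

Lemma natr_expr_bound w n : 0 <= w <= 1 -> n%:R * w ^+ n * (1 - w) <= 1 - w ^+ n.
Proof.
move=> /andP[w0 w1]; elim: n => [|n IH]; first by rewrite !mul0r expr0 subrr.
rewrite -natr1 exprS; have wn : 0 <= w ^+ n <= 1 by rewrite exprn_ge0 ?exprn_ile1.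
move: IH wn; move: (w ^+ n) (n%:R : R) => x n' IH /andP[x0 x1].
have : w * (n' * x * (1 - w)) <= w * (1 - x) by rewrite ler_wpM2l.
have : 0 <= (1 - w) * (1 - w * x) by rewrite mulr_ge0 ?subr_ge0 // mulr_ile1.
by lra.
Qed.

(** With w the square root of y, n y ^ n = (n w ^ n) w ^ n, and n w ^ n is
bounded. *)
Lemma natr_expr_cvg0 y : 0 <= y < 1 -> (fun n => n%:R * y ^+ n) @ \oo --> (0 : R).
Proof.
move=> /andP[y0 y1]; pose w := Num.sqrt y.
have w0 : 0 <= w by exact: sqrtr_ge0.
have w1 : w < 1 by rewrite -sqrtr1 ltr_sqrt.
have yE : y = w * w by rewrite -expr2 sqr_sqrtr.
have cw : (fun n => w ^+ n / (1 - w)) @ \oo --> (0 : R).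
  rewrite -(mul0r (1 - w)^-1); apply: cvgMl; apply: cvg_expr.
  by rewrite ger0_norm.
apply: (@squeeze_cvgr _ _ _ _ (fun=> 0) (fun n => w ^+ n / (1 - w)) _ _ _) => //.
  apply: nearW => n; rewrite mulr_ge0 ?exprn_ge0 //=.
  rewrite ler_pdivlMr ?subr_gt0 // yE exprMn.
  have wn : 0 <= w ^+ n by rewrite exprn_ge0.
  have := @natr_expr_bound w n; rewrite w0 (ltW w1) => /(_ isT).
  by move: (w ^+ n) (n%:R : R) wn => x n'; nra.
exact: cvg_cst.
Qed.

(** Polynomials that converge on [0, 1] to the indicator function of [0, 1/2). The
exponent n 2 ^ n is large enough for the limit at 1/2 to be 0 and small enough
for the limit at y < 1/2 to be 1, since n (2 y) ^ n tends to 0. *)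
Definition step_approx n y := (1 - y ^+ n) ^+ (n * 2 ^ n).

Lemma step_approx_bounds n y : 0 <= y <= 1 -> 0 <= step_approx n y <= 1.
Proof.
move=> /andP[y0 y1]; have y1n : 0 <= y ^+ n <= 1 by rewrite exprn_ge0 ?exprn_ile1.
have /andP[a b] := y1n.
by rewrite exprn_ge0 ?exprn_ile1 // ?subr_ge0 // gerBl.
Qed.

Lemma step_approx_cvg y : 0 <= y <= 1 ->
  step_approx n y @[n --> \oo] --> (if y < 1 / 2 then 1 else 0 : R).
Proof.
move=> y01; have /andP[y0 y1] := y01.
have yn n : 0 <= y ^+ n <= 1 by rewrite exprn_ge0 ?exprn_ile1.
have [yl|yl] := ltP y (1 / 2).
  have c1 : (fun n => 1 - n%:R * (2 * y) ^+ n) @ \oo --> (1 : R).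
    rewrite -[X in _ --> X]subr0; apply: cvgB; first exact: cvg_cst.
    by apply: natr_expr_cvg0; rewrite mulr_ge0 //=; lra.
  apply: (squeeze_cvgr _ c1 (@cvg_cst _ _ _ _ _)).
  apply: nearW => n; have /andP[_ ->] := step_approx_bounds n y01; rewrite andbT.
  apply: le_trans (bernoulli_lower (n * 2 ^ n) (yn n)).
  by rewrite natrM natrX exprMn mulrA.
have c0 : (fun n => (n.+1%:R)^-1) @ \oo --> (0 : R) by exact: cvg_harmonic.
apply: (squeeze_cvgr _ (@cvg_cst _ _ _ _ _) c0).
apply: nearW => n; have /andP[-> _] := step_approx_bounds n y01 => /=.
have hn : 0 <= (1 / 2 : R) ^+ n <= 1 by rewrite exprn_ge0 ?exprn_ile1 //; lra.
apply: (@le_trans _ _ ((1 - (1 / 2) ^+ n) ^+ (n * 2 ^ n))).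
  have /andP[_ ?] := yn n.
  apply: lerXn2r; rewrite ?nnegrE ?subr_ge0 //; first by case/andP: hn.
  by rewrite lerB // lerXn2r ?nnegrE //; lra.
rewrite -[leRHS]mul1r ler_pdivlMr //.
have := bernoulli_upper (n * 2 ^ n) hn.
rewrite natrM natrX -mulrA -exprMn mul1r divff // expr1n mulr1.
by rewrite -[n.+1%:R]natr1 [_ + 1]addrC.
Qed.
End step_polynomials.

Section fourier_uniqueness.
Variables (R : realType) (V : zmodType) (en : nat -> V).
Hypothesis en_surj : forall v, exists n, en n = v.
Notation X := (borel (pdual R V)).
Implicit Types (f g : X -> R) (u v : V).

Inductive trigonometric : (X -> R) -> Prop :=
| trigonometric_re v : trigonometric (re v)
| trigonometric_im v : trigonometric (im v)
| trigonometric_lin a f g : trigonometric f -> trigonometric g ->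
    trigonometric (fun xi => a * f xi + g xi).

Lemma trigonometricZ a f : trigonometric f -> trigonometric (fun xi => a * f xi).
Proof.
move=> tf; have := trigonometric_lin (a - 1) tf tf.
by under eq_fun do rewrite mulrBl mul1r subrK.
Qed.

Lemma trigonometricD f g : trigonometric f -> trigonometric g ->
  trigonometric (fun xi => f xi + g xi).
Proof.
by move=> tf tg; have := trigonometric_lin 1 tf tg; under eq_fun do rewrite mul1r.
Qed.

Lemma trigonometric_cst a : trigonometric (fun=> a).
Proof.
have := trigonometricZ a (trigonometric_re 0).
by under eq_fun do rewrite re0 mulr1.
Qed.

(** The addition formulas turn a product of two characters into a sum. *)
Lemma trigonometricM f g : trigonometric f -> trigonometric g ->
  trigonometric (fun xi => f xi * g xi).
Proof.
have rere u v : trigonometric (fun xi => re u xi * re v xi).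
  have := trigonometricZ (1 / 2)
    (trigonometricD (trigonometric_re (u + v)) (trigonometric_re (u - v))).
  by congr trigonometric; apply: funext => xi; rewrite !reD reN imN; field.
have imim u v : trigonometric (fun xi => im u xi * im v xi).
  have := trigonometricZ (- (1 / 2))
    (trigonometric_lin (- 1) (trigonometric_re (u - v)) (trigonometric_re (u + v))).
  by congr trigonometric; apply: funext => xi; rewrite !reD reN imN; field.
have reim u v : trigonometric (fun xi => re u xi * im v xi).
  have := trigonometricZ (1 / 2)
    (trigonometric_lin (- 1) (trigonometric_im (u - v)) (trigonometric_im (u + v))).
  by congr trigonometric; apply: funext => xi; rewrite !imD reN imN; field.
move=> tf tg; elim: tf => [u|u|a f1 f2 _ IH1 _ IH2].
- elim: tg => [v|v|a f1 f2 _ IH1 _ IH2]; [exact: rere|exact: reim|].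
  have := trigonometric_lin a IH1 IH2.
  by congr trigonometric; apply: funext => xi; ring.
- elim: tg => [v|v|a f1 f2 _ IH1 _ IH2]; [|exact: imim|].
    by under eq_fun do rewrite mulrC; exact: reim.
  have := trigonometric_lin a IH1 IH2.
  by congr trigonometric; apply: funext => xi; ring.
have := trigonometric_lin a IH1 IH2.
by congr trigonometric; apply: funext => xi; ring.
Qed.

Lemma trigonometricX f n : trigonometric f -> trigonometric (fun xi => f xi ^+ n).
Proof.
move=> tf; elim: n => [|n IH]; first exact: trigonometric_cst.
by under eq_fun do rewrite exprS; exact: trigonometricM.
Qed.

Lemma trigonometric_prod (I : Type) (r : seq I) (F : I -> X -> R) :
  (forall i, trigonometric (F i)) -> trigonometric (fun xi => \prod_(i <- r) F i xi).
Proof.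
move=> tF; elim: r => [|i r IH].
  by under eq_fun do rewrite big_nil; exact: trigonometric_cst.
by under eq_fun do rewrite big_cons; exact: trigonometricM.
Qed.

Lemma bounded_measurable_trigonometric f : trigonometric f -> bounded_measurable f.
Proof.
elim=> [v|v|a f1 f2 _ b1 _ b2].
- exact: bounded_measurable_re.
- exact: bounded_measurable_im.
- exact: bounded_measurable_lin.
Qed.

(** Functionals of the form g |-> integral of f g, and differences of such,
treated at once: linear and continuous under bounded pointwise convergence. *)
Definition integral_like (L : (X -> R) -> R) :=
  (forall a f g, bounded_measurable f -> bounded_measurable g ->
     L (fun xi => a * f xi + g xi) = a * L f + L g) /\
  (forall (F : nat -> X -> R) f, (forall n, measurable_fun setT (F n)) ->
     (forall n xi, `|F n xi| <= 1) -> (forall xi, F n xi @[n --> \oo] --> f xi) ->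
     bounded_measurable f -> L (F n) @[n --> \oo] --> L f).

Section vanishing_functional.
Variable L : (X -> R) -> R.
Hypothesis LI : integral_like L.
Hypothesis Lre : forall v, L (re v) = 0.
Hypothesis Lim : forall v, L (im v) = 0.

Lemma functional_trigonometric f : trigonometric f -> L f = 0.
Proof.
elim=> [v|v|a f1 f2 t1 L1 t2 L2]; [exact: Lre|exact: Lim|].
have [lin _] := LI; rewrite lin ?L1 ?L2 ?mulr0 ?addr0 //;
  exact: bounded_measurable_trigonometric.
Qed.

(** An affine function of a coordinate with values in [0, 1] that is below 1/2
exactly on the half space h. *)
Definition normalized_coordinate (h : bool * bool * nat * rat) (xi : X) : R :=
  1 / 2 + ((-1) ^+ h.1.1.1 * coordinate h.1.1.2 (xi : pdual R V) (en h.1.2) - ratr h.2) /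
    (2 * (2 + `|ratr h.2|)).

Lemma normalized_coordinate_trigonometric h : trigonometric (normalized_coordinate h).
Proof.
have tc : trigonometric (fun xi : X => coordinate h.1.1.2 (xi : pdual R V) (en h.1.2)).
  by rewrite /coordinate; case: h.1.1.2; [exact: trigonometric_re|exact: trigonometric_im].
have := trigonometric_lin ((-1) ^+ h.1.1.1 / (2 * (2 + `|ratr h.2|))) tc
  (trigonometric_cst (1 / 2 - ratr h.2 / (2 * (2 + `|ratr h.2|)))).
by congr trigonometric; apply: funext => xi; rewrite /normalized_coordinate; ring.
Qed.

Lemma normalized_coordinate_bounds h xi : 0 <= normalized_coordinate h xi <= 1.
Proof.
rewrite /normalized_coordinate.
have : `|(-1) ^+ h.1.1.1 * coordinate h.1.1.2 (xi : pdual R V) (en h.1.2)| <= 1.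
  rewrite normrM normrX normrN1 expr1n mul1r /coordinate.
  by case: h.1.1.2; [exact: re_bound|exact: im_bound].
rewrite ler_norml; move: (_ * coordinate _ _ _) => c /andP[c1 c2].
move: (ratr h.2 : R) => q.
have d0 : 0 < 2 * (2 + `|q|) by rewrite mulr_gt0 // ltr_wpDr.
have := ler_norm q; have := ler_norm (- q); rewrite normrN => q1 q2.
have h1 : (c - q) / (2 * (2 + `|q|)) <= 1 / 2 by rewrite ler_pdivrMr //; lra.
have h2 : - (1 / 2) <= (c - q) / (2 * (2 + `|q|)) by rewrite ler_pdivlMr //; lra.
by apply/andP; split; lra.
Qed.

Lemma normalized_coordinate_half h xi :
  (normalized_coordinate h xi < 1 / 2) = `[< half_space en h (xi : pdual R V) >].
Proof.
rewrite asboolb /normalized_coordinate gtrDl pmulr_llt0 ?subr_lt0 //.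
Qed.

Lemma measurable_half_space h :
  measurable [set xi : X | half_space en h (xi : pdual R V)].
Proof.
have [mh _] := bounded_measurable_trigonometric (normalized_coordinate_trigonometric h).
have := mh measurableT `]-oo, (1 / 2)[%classic (measurable_itv _).
rewrite setTI; congr measurable; apply/seteqP; split=> xi /=;
  by rewrite in_itv /= normalized_coordinate_half asboolb.
Qed.

Lemma measurable_cylinder l : measurable (cylinder_set en l : set X).
Proof.
elim: l => [|h l IH].
  by rewrite (_ : cylinder_set _ _ = setT) //; apply/seteqP; split.
rewrite (_ : cylinder_set _ _ = [set xi : X | half_space en h (xi : pdual R V)] `&`
  cylinder_set en l); first exact: measurableI (measurable_half_space h) IH.
apply/seteqP; split=> [xi hl|xi [hh hl] k].
  by split=> [|k kl]; apply: hl; rewrite inE ?eqxx ?kl ?orbT.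
by rewrite inE => /predU1P[->|/hl].
Qed.

(** Products of step polynomials in the coordinates are trigonometric polynomials and
converge to the indicator function of the cylinder. *)
Lemma functional_cylinder l : L \1_(cylinder_set en l) = 0.
Proof.
have [_ Lcvg] := LI.
pose F n (xi : X) := \prod_(h <- l) step_approx n (normalized_coordinate h xi).
have tF n : trigonometric (F n).
  apply: trigonometric_prod => h; apply: trigonometricX.
  have := trigonometric_lin (-1) (trigonometricX n (normalized_coordinate_trigonometric h))
    (trigonometric_cst 1).
  by congr trigonometric; apply: funext => xi; ring.
have F01 n xi : 0 <= F n xi <= 1.
  have s01 h := step_approx_bounds n (normalized_coordinate_bounds h xi).
  rewrite /F; elim: (l) => [|h l' /andP[p0 p1]]; first by rewrite big_nil ler01 lexx.
  have /andP[s0 s1] := s01 h.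
  by rewrite big_cons mulr_ge0 //= mulr_ile1.
have Fc xi : F n xi @[n --> \oo] --> (\1_(cylinder_set en l) xi : R).
  have c h := @step_approx_cvg _ _ (normalized_coordinate_bounds h xi).
  suff -> : (\1_(cylinder_set en l) xi : R) =
      \prod_(h <- l) (if normalized_coordinate h xi < 1 / 2 then 1 else 0).
    rewrite /F; elim: (l) => [|h l' IH].
      by under eq_fun do rewrite big_nil; rewrite big_nil; exact: cvg_cst.
    by under eq_fun do rewrite big_cons; rewrite big_cons; exact: cvgM.
  rewrite indicE; have [/set_mem xil|/negP xil] := boolP (_ \in _).
    rewrite big_seq big1 // => h hl; rewrite normalized_coordinate_half.
    by rewrite asboolT //; exact: xil.
  have /existsNP[h /not_implyP[hl hN]] : ~ cylinder en l (xi : pdual R V).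
    by move=> cl; apply: xil; exact: mem_set.
  by rewrite (big_rem h) //= normalized_coordinate_half asboolF // mul0r.
have mC := measurable_cylinder l.
have cvgF : L (F n) @[n --> \oo] --> L \1_(cylinder_set en l).
  apply: Lcvg => // [n|n xi|].
  - by case: (bounded_measurable_trigonometric (tF n)).
  - by have /andP[F0 F1] := F01 n xi; rewrite ger0_norm.
  - exact: bounded_measurable_indic.
have LF0 : (fun n => L (F n)) = fun=> 0.
  by apply: funext => n; rewrite functional_trigonometric.
rewrite LF0 in cvgF.
exact: (cvg_unique (@Rhausdorff R) cvgF (cvg_cst _)).
Qed.

(** Uniqueness of Fourier coefficients: a functional that vanishes on the characters
vanishes on the indicator functions of the Borel sets. *)
Lemma functional_borel (A : set X) : measurable A -> L \1_A = 0.
Proof.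
have [Llin Lcvg] := LI => mA.
pose D := [set B : set (pdual R V) |
  measurable (B : set X) /\ L (\1_(B : set X)) = 0].
suff /(_ A mA)[] : forall A : set X, measurable A -> D A by [].
have DT : D setT.
  split; first exact: measurableT.
  have -> : \1_(setT : set X) = \1_(cylinder_set en [::]) :> (X -> R).
    by congr indic; apply/seteqP; split.
  exact: functional_cylinder.
apply: (borel_cylinder_induction en_surj) => [|l]; last first.
  split; last exact: functional_cylinder.
  exact: measurable_cylinder.
split=> // [B [mB LB]|F tF DF].
  split; first exact: measurableC.
  have -> : \1_(~` (B : set X)) =
      (fun xi : X => -1 * \1_(B : set X) xi + \1_(setT : set X) xi) :> (X -> R).
    apply: funext => xi; rewrite !indicE in_setC in_setT.
    by case: (_ \in _) => /=; rewrite ?mulr0 ?mulr1 ?add0r ?addNr.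
  rewrite Llin ?LB ?(DT.2) ?mulr0 ?addr0 //; exact: bounded_measurable_indic.
have mF n : measurable (F n : set X) by have [] := DF n.
have mU : measurable (\bigcup_k F k : set X) by exact: bigcup_measurable.
split=> //.
pose G n : set X := \bigcup_(k < n) F k.
have mG n : measurable (G n) by exact: bigcup_measurable.
have LG n : L \1_(G n) = 0.
  elim: n => [|n IH].
    have -> : G 0%N = ~` setT by rewrite /G setCT; apply: bigcup0 => k.
    have -> : \1_(~` (setT : set X)) =
        (fun xi : X => -1 * \1_(setT : set X) xi + re 0 xi) :> (X -> R).
      by apply: funext => xi; rewrite re0 !indicE setCT in_setT in_set0 mulr1 addNr.
    rewrite Llin ?(DT.2) ?Lre ?mulr0 ?addr0 //.
      exact: bounded_measurable_indic.
    exact: bounded_measurable_re.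
  have -> : \1_(G n.+1) =
      (fun xi : X => 1 * \1_(G n) xi + \1_(F n : set X) xi) :> (X -> R).
    apply: funext => xi; rewrite !indicE mul1r.
    have -> : G n.+1 = G n `|` F n.
      apply/seteqP; split=> [x [k /= kn Fx]|x [[k /= kn Fx]|Fx]].
      - move: kn; rewrite ltnS leq_eqVlt => /predU1P[kn|kn]; first by right; rewrite -kn.
        by left; exists k.
      - by exists k => //=; rewrite ltnS ltnW.
      - by exists n => /=.
    rewrite in_setU; have [/set_mem Gxi|Gxi] := boolP (xi \in G n); last first.
      by rewrite add0r.
    suff /negPf -> : xi \notin (F n : set X) by rewrite addr0.
    apply/negP => /set_mem Fxi; have [k /= kn Fkxi] := Gxi.
    have /(_ k n I I) := tF; suff e : F k `&` F n !=set0.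
      by move=> /(_ e) kn'; rewrite kn' ltnn in kn.
    by exists xi.
  by rewrite Llin ?IH ?(DF n).2 ?mulr0 ?addr0 //; exact: bounded_measurable_indic.
have cvgG : L \1_(G n) @[n --> \oo] --> L \1_(\bigcup_k F k : set X).
  apply: Lcvg => [n|n xi|xi|].
  - exact: measurable_indic.
  - by rewrite indicE; case: (_ \in _); rewrite ?normr1 ?normr0.
  - rewrite !indicE; have [/set_mem [k _ Fk]|nF] := boolP (xi \in _).
      apply: cvg_near_cst; exists k.+1 => // n /= kn.
      by rewrite indicE mem_set //; exists k.
    apply: cvg_near_cst; apply: nearW => n; rewrite indicE.
    have /negPf -> // : xi \notin G n.
    apply: contra nF => /set_mem[k _ Fk]; apply/mem_set; by exists k.
  - exact: bounded_measurable_indic.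
have LG0 : (fun n => L \1_(G n)) = fun=> 0 by apply: funext => n; exact: LG.
rewrite LG0 in cvgG.
exact: (cvg_unique (@Rhausdorff R) cvgG (cvg_cst _)).
Qed.
End vanishing_functional.
End fourier_uniqueness.

(** * Fourier coefficients of an invariant measure *)

Section image_measures.
Context d d' (T : measurableType d) (T' : measurableType d') (R : realType).
Variable P : probability T R.

Lemma integral_ae (f g : T -> R) : bounded_measurable f -> bounded_measurable g ->
  {ae P, forall x, f x = g x} -> \int[P]_x f x = \int[P]_x g x.
Proof.
move=> [mf _] [mg _] fg; congr fine; apply: ae_eq_integral => //.
- exact/measurable_EFinP.
- exact/measurable_EFinP.
- by apply: filterS fg => x fgx _; rewrite fgx.
Qed.

Lemma bounded_measurable_comp (f : T -> T') (g : T' -> R) : measurable_fun setT f ->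
  bounded_measurable g -> bounded_measurable (g \o f).
Proof.
move=> mf [mg [M gM]]; split; first exact: measurableT_comp.
by exists M => x /=.
Qed.

Lemma image_probability (f : T -> T') : measurable_fun setT f ->
  exists Q : probability T' R, (forall A, Q A = P (f @^-1` A)) /\
    forall g : T' -> R, bounded_measurable g -> \int[Q]_y g y = \int[P]_x g (f x).
Proof.
move=> mf.
pose F : {mfun T >-> T'} := HB.pack f (isMeasurableFun.Build _ _ _ _ f mf).
exists (distribution P F); split=> // g bg.
congr fine; rewrite /= integral_pushforward //.
- by apply/measurable_EFinP; case: bg.
- exact: bounded_measurable_integrable (bounded_measurable_comp mf bg).
Qed.
End image_measures.

Lemma integral_measure_preserving d (T : measurableType d) (R : realType)
    (P : probability T R) (f : T -> T) (g : T -> R) : measurable_fun setT f ->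
  (forall A, measurable A -> P (f @^-1` A) = P A) -> bounded_measurable g ->
  \int[P]_x g (f x) = \int[P]_x g x.
Proof.
move=> mf Pf bg; have [Q [QP Qint]] := image_probability P mf.
rewrite -Qint //; congr fine; apply: eq_measure_integral => A mA _.
exact: etrans (QP A) (Pf A mA).
Qed.

Section measurable_into_dual.
Variables (R : realType) (U : zmodType) (en : nat -> U).
Hypothesis en_surj : forall v, exists n, en n = v.

Lemma measurable_into_dual d (T : measurableType d) (f : T -> borel (pdual R U)) :
  (forall u, measurable_fun setT (fun x => re u (f x))) ->
  (forall u, measurable_fun setT (fun x => im u (f x))) -> measurable_fun setT f.
Proof.
move=> mre mim _ A mA; rewrite setTI.
pose D := [set B : set (pdual R U) | measurable (f @^-1` B)].
suff : D A by [].
apply: (borel_cylinder_induction en_surj) mA; first split.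
- by rewrite /D /= preimage_setT.
- by move=> B mB; rewrite /D /= preimage_setC; exact: measurableC.
- by move=> F _ mF; rewrite /D /= preimage_bigcup; apply: bigcup_measurable => n _; exact: mF.
move=> l; rewrite /D /=; elim: l => [|h l IH].
  by rewrite (_ : _ @^-1` _ = setT) //; apply/seteqP; split.
rewrite (_ : _ @^-1` _ = [set x | half_space en h (f x : pdual R U)] `&`
  (f @^-1` cylinder_set en l)); last first.
  apply/seteqP; split=> [x hl|x [hh hl] k].
    by split=> [|k kl]; apply: hl; rewrite inE ?eqxx ?kl ?orbT.
  by rewrite inE => /predU1P[->|/hl].
apply: measurableI => //.
have mh : measurable_fun setT (fun x => (-1) ^+ h.1.1.1 *
    coordinate h.1.1.2 (f x : pdual R U) (en h.1.2)).
  apply: measurable_funM; first exact: measurable_cst.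
  by rewrite /coordinate; case: h.1.1.2; [exact: mre|exact: mim].
have := mh measurableT `]-oo, (ratr h.2)[%classic (measurable_itv _).
by rewrite setTI; congr measurable; apply/seteqP; split=> x /=; rewrite in_itv.
Qed.
End measurable_into_dual.

Section invariant_measures.
Variables (R : realType) (K : fieldType) (V : lmodType K) (en : nat -> V).
Hypothesis en_surj : forall v, exists n, en n = v.
Variable theta : probability (borel (pdual R V)) R.

Definition fourier_re (v : V) := \int[theta]_xi re v xi.
Definition fourier_im (v : V) := \int[theta]_xi im v xi.

Lemma norm_sum_character N (u : 'I_N -> V) xi :
  (\sum_a re (u a) xi) ^+ 2 + (\sum_a im (u a) xi) ^+ 2 =
  \sum_a \sum_b (re (u a - u b) xi : R).
Proof.
rewrite !expr2 !mulr_suml -big_split /=; apply: eq_bigr => a _.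
rewrite !mulr_sumr -big_split /=; apply: eq_bigr => b _.
by rewrite reD reN imN; ring.
Qed.

(** The squared norm of the sum of the characters u_a in the L2 space of theta. *)
Lemma fourier_gram N (u : 'I_N -> V) :
  \sum_a \sum_b fourier_re (u a - u b) =
  \int[theta]_xi ((\sum_a re (u a) xi) ^+ 2 + (\sum_a im (u a) xi) ^+ 2).
Proof.
have bre v : bounded_measurable (re v : borel (pdual R V) -> R).
  exact: bounded_measurable_re.
under [RHS]eq_Rintegral do rewrite norm_sum_character.
rewrite integral_sum => [|a]; last exact: bounded_measurable_sum.
by apply: eq_bigr => a _; rewrite integral_sum.
Qed.

Lemma fourier_square_le N (u : 'I_N -> V) (f : V -> borel (pdual R V) -> R) :
  (forall v, bounded_measurable (f v)) ->
  (forall xi, (\sum_a f (u a) xi) ^+ 2 <=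
     (\sum_a re (u a) xi) ^+ 2 + (\sum_a im (u a) xi) ^+ 2) ->
  (\sum_a \int[theta]_xi f (u a) xi) ^+ 2 <= \sum_a \sum_b fourier_re (u a - u b).
Proof.
move=> bf fle; rewrite -integral_sum // fourier_gram.
apply: le_trans (integral_square_ge _ _) _; first exact: bounded_measurable_sum.
apply: integral_le => // [|].
  under eq_fun do rewrite expr2.
  by apply: bounded_measurableM; exact: bounded_measurable_sum.
under eq_fun do rewrite !expr2.
by apply: bounded_measurableD; apply: bounded_measurableM;
  apply: bounded_measurable_sum => a;
  solve [exact: bounded_measurable_re | exact: bounded_measurable_im].
Qed.

Lemma fourier_re_square_le N (u : 'I_N -> V) :
  (\sum_a fourier_re (u a)) ^+ 2 <= \sum_a \sum_b fourier_re (u a - u b).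
Proof.
have := @fourier_square_le N u (fun v xi => re v xi); apply=> [v|xi].
  exact: bounded_measurable_re.
by rewrite lerDl sqr_ge0.
Qed.

Lemma fourier_im_square_le N (u : 'I_N -> V) :
  (\sum_a fourier_im (u a)) ^+ 2 <= \sum_a \sum_b fourier_re (u a - u b).
Proof.
have := @fourier_square_le N u (fun v xi => im v xi); apply=> [v|xi].
  exact: bounded_measurable_im.
by rewrite lerDr sqr_ge0.
Qed.

Lemma measurable_dual_map (U : zmodType) (eU : nat -> U) (f : {additive U -> V}) :
  (forall u, exists n, eU n = u) ->
  measurable_fun setT (dual_map f : borel (pdual R V) -> borel (pdual R U)).
Proof.
move=> eU_surj; apply: (measurable_into_dual eU_surj) => u.
  by have [] := bounded_measurable_re R (f u).
by have [] := bounded_measurable_im R (f u).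
Qed.

Lemma fourier_invariant (rho : K -> {linear V -> V}) a v :
  dual_invariant rho theta -> a != 0 ->
  fourier_re (rho a v) = fourier_re v /\ fourier_im (rho a v) = fourier_im v.
Proof.
move=> inv a0; have md := @measurable_dual_map V en (rho a) en_surj.
split.
  apply: (integral_measure_preserving md) => [A mA|]; first exact: inv.
  exact: bounded_measurable_re.
apply: (integral_measure_preserving md) => [A mA|]; first exact: inv.
exact: bounded_measurable_im.
Qed.
End invariant_measures.

(** * Averages along a line *)

Section boxes.
Variable K : fieldType.

(** With multiplicities, so that the sum of a character over it is a product of
geometric sums. *)
Definition box (n : nat) (gs : seq K) : seq K :=
  foldr (fun g Z => [seq z + g *+ b | z <- Z, b <- iota 0 n]) [:: 0] gs.

Lemma size_box n gs : size (box n gs) = (n ^ size gs)%N.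
Proof. by elim: gs => //= g gs IH; rewrite size_allpairs size_iota IH expnSr. Qed.

Variables (R : realType) (V : lmodType K) (w : V) (xi : pdual R V).
Let chi (z : K) : R[i] := xi (z *: w).

Lemma chiD x y : chi (x + y) = chi x * chi y.
Proof. by rewrite /chi scalerDl; case: (pdual_funP xi) => _ ->. Qed.

Lemma chiMn x b : chi (x *+ b) = chi x ^+ b.
Proof.
elim: b => [|b IH]; first by rewrite mulr0n /chi scale0r char0.
by rewrite mulrS chiD IH exprS.
Qed.

Lemma norm_chi x : `|chi x| = 1. Proof. by case: (pdual_funP xi) => ->. Qed.

Lemma norm_geometric_le (n : nat) x : `|\sum_(b < n) chi x ^+ b| <= n%:R.
Proof.
apply: le_trans (ler_norm_sum _ _ _) _.
under eq_bigr do rewrite normrX norm_chi expr1n.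
by rewrite sumr_const card_ord.
Qed.

Lemma norm_geometric_gap (n : nat) x :
  `|\sum_(b < n) chi x ^+ b| * `|chi x - 1| <= 2%:R.
Proof.
rewrite -normrM mulrC -subrX1; apply: le_trans (ler_normB _ _) _.
by rewrite normrX norm_chi expr1n normr1.
Qed.

Lemma box_sum_cons n g gs :
  \sum_(z <- box n (g :: gs)) chi z =
  (\sum_(z <- box n gs) chi z) * \sum_(b < n) chi g ^+ b.
Proof.
rewrite /= big_allpairs_dep /= mulr_suml; apply: eq_bigr => z _.
rewrite mulr_sumr -(big_mkord xpredT (fun b => chi z * chi g ^+ b)).
by rewrite /index_iota subn0; apply: eq_bigr => b _; rewrite chiD chiMn.
Qed.

Lemma box_sum_le n gs : `|\sum_(z <- box n gs) chi z| <= n%:R ^+ size gs.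
Proof.
elim: gs => [|g gs IH]; first by rewrite big_seq1 norm_chi expr0.
rewrite box_sum_cons normrM exprSr ler_pM //; exact: norm_geometric_le.
Qed.

(** The factor of the product that belongs to g is at most 2 / |chi g - 1|, and each
of the others is at most n in absolute value. *)
Lemma box_sum_gap n gs g : g \in gs ->
  `|\sum_(z <- box n gs) chi z| * `|chi g - 1| * n%:R <= 2%:R * n%:R ^+ size gs.
Proof.
elim: gs => // h gs IH; rewrite inE box_sum_cons normrM [size _]/= exprSr mulrA.
case/predU1P => [->|/IH {}IH].
  rewrite ler_pM // -mulrA mulrC ler_pM //; first exact: norm_geometric_gap.
  exact: box_sum_le.
rewrite -[X in X * n%:R <= _]mulrA [X in _ * X * _ <= _]mulrC !mulrA.
rewrite -mulrA [X in _ * X <= _]mulrC mulrA ler_pM //.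
exact: norm_geometric_le.
Qed.

Lemma box_square_gap n gs g : g \in gs ->
  ((\sum_(z <- box n gs) re (z *: w) xi) ^+ 2 +
   (\sum_(z <- box n gs) im (z *: w) xi) ^+ 2) *
  ((re (g *: w) xi - 1) ^+ 2 + im (g *: w) xi ^+ 2) * n%:R ^+ 2 <=
  4 * ((size (box n gs))%:R : R) ^+ 2.
Proof.
move=> /(box_sum_gap n) gap.
have ReE : complex.Re (\sum_(z <- box n gs) chi z) = \sum_(z <- box n gs) re (z *: w) xi.
  by apply: (big_morph (@complex.Re R)) => // -[? ?] [? ?].
have ImE : complex.Im (\sum_(z <- box n gs) chi z) = \sum_(z <- box n gs) im (z *: w) xi.
  by apply: (big_morph (@complex.Im R)) => // -[? ?] [? ?].
have Re1 : complex.Re (chi g - 1) = re (g *: w) xi - 1.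
  by rewrite /re /chi; case: (xi _).
have Im1 : complex.Im (chi g - 1) = im (g *: w) xi.
  by rewrite /im /chi; case: (xi _) => ? ? /=; rewrite subr0.
rewrite -lecR -ReE -ImE -Re1 -Im1 !rmorphM /= !add_Re2_Im2 !rmorph_nat.
rewrite size_box natrX.
have p0 : 0 <= `|\sum_(z <- box n gs) chi z| * `|chi g - 1| * n%:R by rewrite !mulr_ge0.
have := ler_pM p0 p0 gap gap.
by congr (_ <= _); ring.
Qed.
End boxes.

Section averages_along_lines.
Variables (R : realType) (K : fieldType) (V : lmodType K) (enK : nat -> K).
Hypothesis enK_surj : forall x, exists n, enK n = x.
Hypothesis infK : forall B : seq K, exists x, x \notin B.
Variable theta : probability (borel (pdual R V)) R.

(** The square of the absolute value of the mean of the character xi over an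
increasing sequence of boxes that exhausts the line K w. *)
Definition box_density (n : nat) (w : V) (xi : borel (pdual R V)) : R :=
  let Z := box n.+1 [seq enK k | k <- iota 0 n.+1] in
  ((\sum_(z <- Z) re (z *: w) xi) ^+ 2 + (\sum_(z <- Z) im (z *: w) xi) ^+ 2) /
  (size Z)%:R ^+ 2.

Lemma size_box_gt0 n (gs : seq K) : 0 < (size (box n.+1 gs))%:R :> R.
Proof. by rewrite size_box ltr0n expn_gt0. Qed.

Lemma bounded_measurable_box_density n w : bounded_measurable (box_density n w).
Proof.
rewrite /box_density; under eq_fun do rewrite mulrC !expr2.
apply: bounded_measurableZ; apply: bounded_measurableD; apply: bounded_measurableM;
  apply: bounded_measurable_sum => z;
  solve [exact: bounded_measurable_re | exact: bounded_measurable_im].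
Qed.

Lemma box_density_bounds n w xi : 0 <= box_density n w xi <= 2.
Proof.
rewrite /box_density; set Z := box _ _.
have s0 := size_box_gt0 n [seq enK k | k <- iota 0 n.+1]; rewrite -/Z in s0.
rewrite divr_ge0 ?addr_ge0 ?sqr_ge0 //= ler_pdivrMr ?exprn_gt0 //.
have sum_bound (f : K -> R) : (forall z, `|f z| <= 1) ->
    (\sum_(z <- Z) f z) ^+ 2 <= (size Z)%:R ^+ 2.
  move=> f1; rewrite -real_normK ?num_real // lerXn2r ?nnegrE //.
  apply: le_trans (ler_norm_sum _ _ _) _.
  have -> : (size Z)%:R = \sum_(z <- Z) (1 : R).
    by rewrite big_const_seq count_predT iter_addr addr0.
  by apply: ler_sum.
by rewrite mulr2n mulrDl !mul1r lerD // sum_bound // => z;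
  [exact: re_bound|exact: im_bound].
Qed.

Lemma box_density_cvg w (xi : pdual R V) : (exists k, xi (k *: w) != 1) ->
  box_density n w xi @[n --> \oo] --> (0 : R).
Proof.
case=> k; have [j <-] := enK_surj k => xik.
set d := (re (enK j *: w) xi - 1) ^+ 2 + im (enK j *: w) xi ^+ 2.
have d0 : 0 < d.
  rewrite lt_neqAle addr_ge0 ?sqr_ge0 // andbT eq_sym paddr_eq0 ?sqr_ge0 //.
  apply: contraNN xik => /andP[]; rewrite !sqrf_eq0 subr_eq0 => /eqP re1 _.
  by apply/eqP/char_eq1.
have c0 : (fun n => 4 / d * (n.+1%:R)^-1) @ \oo --> (0 : R).
  by rewrite -(mulr0 (4 / d)); apply: cvgMr; exact: cvg_harmonic.
apply: (squeeze_cvgr _ (@cvg_cst _ _ _ _ _) c0).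
exists j => // n /= jn; have /andP[-> _] := box_density_bounds n w xi => /=.
have jin : enK j \in [seq enK k | k <- iota 0 n.+1].
  by apply: map_f; rewrite mem_iota add0n ltnS.
have := box_square_gap w xi n.+1 jin.
rewrite -/d /box_density; set Z := box _ _.
have s0 := size_box_gt0 n [seq enK k | k <- iota 0 n.+1]; rewrite -/Z in s0.
have : 0 <= (\sum_(z <- Z) re (z *: w) xi) ^+ 2 + (\sum_(z <- Z) im (z *: w) xi) ^+ 2.
  by rewrite addr_ge0 ?sqr_ge0.
have n1 : 1 <= n.+1%:R :> R by rewrite ler1n.
have n0 : 0 < n.+1%:R :> R by rewrite ltr0n.
move: (_ + _) (n.+1%:R : R) n1 n0 => N2 q q1 q0 N20 H.
rewrite ler_pdivrMr ?exprn_gt0 //.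
have -> : 4 / d * q^-1 * (size Z)%:R ^+ 2 = 4 * (size Z)%:R ^+ 2 / (d * q).
  by field; rewrite !gt_eqF.
rewrite ler_pdivlMr ?mulr_gt0 //; apply: le_trans H.
by rewrite mulrA ler_wpM2l ?mulr_ge0 ?(ltW d0) // expr2 ler_peMr // ltW.
Qed.

(** The mean of a nontrivial character over the boxes tends to 0, so the mean square
of the averages tends to 0 by dominated convergence. This is unaffected by a
translation of the box, which is used to avoid B. *)
Lemma small_line_averages (v : V) :
  {ae theta, forall xi : borel (pdual R V), exists k, (xi : pdual R V) (k *: v) != 1} ->
  forall (J : finType) (c : J -> K) (B : seq K) (e : R), (forall j, c j != 0) -> 0 < e ->
  exists X : seq K, [/\ X != [::], {in X, forall x, x \notin B} &
    forall j, \sum_(x <- X) fourier_re theta ((c j * x) *: v) <= e * (size X)%:R].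
Proof.
move=> aev J c B e c0 e0.
have lim j : \int[theta]_xi box_density n (c j *: v) xi @[n --> \oo] --> (0 : R).
  rewrite -[X in _ --> X](integral_cst_prob theta 0).
  apply: (@integral_bounded_cvg _ _ _ _ _ _ 2) => [n|n xi||].
  - by have [] := bounded_measurable_box_density n (c j *: v).
  - by have /andP[? ?] := box_density_bounds n (c j *: v) xi; rewrite ger0_norm.
  - apply: filterS aev => xi [k xik]; apply: box_density_cvg; exists (k / c j).
    by rewrite scalerA divfK.
  - exact: bounded_measurable_cst.
have /choice[M MP] : forall j, exists M, forall n, (M <= n)%N ->
    \int[theta]_xi box_density n (c j *: v) xi <= e ^+ 2.
  move=> j; have e20 : 0 < e ^+ 2 by rewrite exprn_gt0.
  have /cvgrPdist_le /(_ _ e20) [M _ MP] := lim j.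
  exists M => n /MP /=; rewrite sub0r normrN; exact: le_trans (ler_norm _).
pose n := (\max_j M j)%N.
(* The translate of the box by z0 is the sample; differences of its elements do not
   depend on z0. *)
set Z := box n.+1 [seq enK k | k <- iota 0 n.+1].
have s0 : 0 < (size Z)%:R :> R by exact: size_box_gt0.
have [z0 z0P] := infK [seq b - z | b <- B, z <- Z].
exists [seq z0 + z | z <- Z]; split.
- by rewrite -size_eq0 size_map -lt0n -(ltr0n R).
- move=> _ /mapP[z zZ ->]; apply: contra z0P => zB.
  by apply/allpairsP; exists (z0 + z, z); rewrite /= addrK.
move=> j; rewrite size_map big_map.
pose u (a : 'I_(size Z)) := (c j * (z0 + nth 0 Z a)) *: v.
have sumZ (f : K -> R) : \sum_(z <- Z) f z = \sum_(a < size Z) f (nth 0 Z a).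
  by rewrite (big_nth 0) big_mkord.
have sq : (\sum_(z <- Z) fourier_re theta ((c j * (z0 + z)) *: v)) ^+ 2 <=
    (e * (size Z)%:R) ^+ 2.
  rewrite sumZ; apply: le_trans (fourier_re_square_le theta u) _.
  have -> : \sum_a \sum_b fourier_re theta (u a - u b) =
      \int[theta]_xi (box_density n (c j *: v) xi * (size Z)%:R ^+ 2).
    pose w (a : 'I_(size Z)) : V := nth 0 Z a *: (c j *: v).
    transitivity (\sum_a \sum_b fourier_re theta (w a - w b)).
      apply: eq_bigr => a _; apply: eq_bigr => b _; congr (fourier_re _ _).
      rewrite /u /w -scalerBl -mulrBr opprD addrACA subrr add0r.
      by rewrite !scalerA -scalerBl -mulrBl mulrC.
    rewrite fourier_gram; apply: eq_Rintegral => xi _.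
    rewrite /box_density -/Z divfK; last by rewrite expf_neq0 // gt_eqF.
    by rewrite !sumZ.
  under eq_Rintegral do rewrite mulrC.
  rewrite integral_scale; last exact: bounded_measurable_box_density.
  rewrite mulrC exprMn ler_pM2r ?exprn_gt0 //; apply: MP; exact: leq_bigmax.
apply: le_trans (ler_norm _) _; rewrite -ler_sqr ?nnegrE ?mulr_ge0 ?(ltW e0) //.
by rewrite real_normK ?num_real.
Qed.
End averages_along_lines.

(** * Vanishing of the Fourier coefficients *)

Lemma intr_neq0_of_reduced (K : fieldType) (s : nat) (m : 'I_s -> int) i :
  reduced_weights K m -> m i != 0 -> (m i)%:~R != 0 :> K.
Proof.
move=> red mi0; apply/negP => mi.
have mE : `|m i|%:R == 0 :> K.
  by case: (m i) mi => [n|n]; rewrite ?NegzE ?rmorphN ?oppr_eq0.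
have mi_gt0 : (0 < `|m i|)%N by rewrite absz_gt0.
have [p pK] := natf0_pchar mi_gt0 mE.
have /negP := red p i pK; apply; rewrite dvdzE /=.
by rewrite (dvdn_pcharf pK).
Qed.

Section ergodic_weights.
Variables (R : realType) (K : fieldType) (V : lmodType K).
Variables (en : nat -> V) (enK : nat -> K).
Hypothesis en_surj : forall v, exists n, en n = v.
Hypothesis enK_surj : forall x, exists n, enK n = x.
Hypothesis infK : forall B : seq K, exists x, x \notin B.
Variables (rho : K -> {linear V -> V}) (s : nat) (Vs : 'I_s -> submodClosed V).
Variable m : 'I_s -> int.
Hypothesis rho_weight : forall a i v, a != 0 -> v \in Vs i -> rho a v = a ^ m i *: v.
Variable theta : probability (borel (pdual R V)) R.
Hypothesis theta_inv : dual_invariant rho theta.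
Hypothesis theta_erg : dual_ergodic rho theta.

(** Triviality on the whole line K v, not only at v: this makes the condition
invariant under the group if v is a weight vector. *)
Definition trivial_on (v : V) : set (borel (pdual R V)) :=
  [set xi : pdual R V | forall k : K, xi (k *: v) = 1].

Definition ae_trivial_on (v : V) : Prop :=
  {ae theta, forall xi, trivial_on v xi}.

Lemma measurable_trivial_on v : measurable (trivial_on v).
Proof.
have -> : trivial_on v =
    \bigcap_n ([set xi : pdual R V | xi (enK n *: v) = 1] : set (borel (pdual R V))).
  apply/seteqP; split=> [xi xiv n _|xi xiv k]; first exact: xiv.
  by have [n <-] := enK_surj k; exact: (xiv n I).
by apply: bigcapT_measurable => n; exact: measurable_char_eq1.
Qed.

Lemma ae_trivial_dichotomy i v : v \in Vs i -> ae_trivial_on v \/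
  {ae theta, forall xi : borel (pdual R V), exists k, (xi : pdual R V) (k *: v) != 1}.
Proof.
move=> vi; have mt := measurable_trivial_on v.
have [|t0|t1] := theta_erg mt.
- move=> a a0; apply/seteqP; split=> xi xiv k.
    have := xiv (a ^ (- m i) * k); rewrite /= /pdual_fun /=.
    rewrite linearZ /= (rho_weight a0 vi) scalerA mulrAC -expfzDr // addNr.
    by rewrite expr0z mul1r.
  rewrite /= /pdual_fun /= linearZ /= (rho_weight a0 vi) scalerA.
  exact: xiv.
- right; exists (trivial_on v); split=> // xi /= nt k.
  by apply/eqP/negPn/negP => xik; apply: nt; exists k.
left; exists (~` trivial_on v); split=> //; first exact: measurableC.
have := probability_setC theta mt; rewrite t1 subee // => ->.
Qed.

Lemma char_sum (xi : pdual R V) (u : 'I_s -> V) : xi (\sum_i u i) = \prod_i xi (u i).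
Proof.
apply: (big_morph xi) => [x y|]; last exact: char0.
by case: (pdual_funP xi) => _ ->.
Qed.

Lemma ae_trivial_family (u : 'I_s -> V) :
  {ae theta, forall xi : borel (pdual R V), forall i, ae_trivial_on (u i) ->
    (xi : pdual R V) (u i) = 1}.
Proof.
apply: filter_forall => i.
have [ti|ti] := pselect (ae_trivial_on (u i)); last by apply: aeW.
by apply: filterS ti => xi xit _; rewrite -[u i]scale1r; exact: xit.
Qed.

Hypothesis m_inj : injective m.
Hypothesis m0 : forall i, m i != 0.
Hypothesis m_red : reduced_weights K m.

(** The components on whose lines almost every character is trivial do not
contribute to xi (sum_j u_j) and are replaced by 0. By ergodicity almost every
character is nontrivial on the lines of the remaining ones, which makes the
averages along these lines small, as required by [weights_vanish]. *)
Lemma fourier_vanish (u : 'I_s -> V) i : (forall j, u j \in Vs j) ->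
  ~ ae_trivial_on (u i) ->
  fourier_re theta (\sum_j u j) = 0 /\ fourier_im theta (\sum_j u j) = 0.
Proof.
move=> uV nti.
pose vec (r : {ffun 'I_s -> K}) : V := \sum_j r j *: u j.
have vecB r r' : vec (r - r') = vec r - vec r'.
  by rewrite /vec -sumrB; apply: eq_bigr => j _; rewrite !ffunE scalerBl.
have vec_dilate a r : a != 0 -> vec (dilate m a r) = rho a (vec r).
  move=> a0; rewrite /vec linear_sum; apply: eq_bigr => j _.
  by rewrite ffunE (rho_weight a0 (rpredZ _ (uV j))) scalerA.
have vec_single j c : vec (single j c) = c *: u j.
  rewrite /vec (bigD1 j) //= ffunE eqxx big1 ?addr0 // => k kj.
  by rewrite ffunE (negPf kj) scale0r.
(* [vec r] is the sum of the u j without the components trivial almost everywhere *)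
pose r : {ffun 'I_s -> K} := [ffun j => if `[< ae_trivial_on (u j) >] then 0 else 1].
have ae_vec : {ae theta, forall xi : borel (pdual R V),
    (xi : pdual R V) (\sum_j u j) = (xi : pdual R V) (vec r)}.
  apply: filterS (ae_trivial_family u) => xi xiu.
  rewrite /vec !char_sum; apply: eq_bigr => j _; rewrite ffunE.
  by case: asboolP => [/xiu ->|_]; rewrite ?scale0r ?char0 ?scale1r.
have reE : fourier_re theta (\sum_j u j) = fourier_re theta (vec r).
  apply: integral_ae; [exact: bounded_measurable_re|exact: bounded_measurable_re|].
  by apply: filterS ae_vec => xi xie; rewrite /re xie.
have imE : fourier_im theta (\sum_j u j) = fourier_im theta (vec r).
  apply: integral_ae; [exact: bounded_measurable_im|exact: bounded_measurable_im|].
  by apply: filterS ae_vec => xi xie; rewrite /im xie.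
rewrite reE imE.
pose C r := fourier_re theta (vec r); pose S r := fourier_im theta (vec r).
have C0 : C 0 = 1.
  rewrite /C (_ : vec 0 = 0); last by rewrite -(subrr 0) vecB subrr.
  rewrite /fourier_re; under eq_Rintegral do rewrite re0.
  exact: integral_cst_prob.
have Cpos : square_dominated C C.
  move=> N w; apply: le_trans (fourier_re_square_le theta (fun a => vec (w a))) _.
  by apply: ler_sum => a _; apply: ler_sum => b _; rewrite /C vecB.
have Spos : square_dominated S C.
  move=> N w; apply: le_trans (fourier_im_square_le theta (fun a => vec (w a))) _.
  by apply: ler_sum => a _; apply: ler_sum => b _; rewrite /C vecB.
have Cinv : dilation_invariant m C.
  move=> a x a0; rewrite /C vec_dilate //.
  by case: (fourier_invariant en_surj (vec x) theta_inv a0).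
have Sinv : dilation_invariant m S.
  move=> a x a0; rewrite /S vec_dilate //.
  by case: (fourier_invariant en_surj (vec x) theta_inv a0).
have r0 : r != 0.
  apply/eqP => /ffunP /(_ i); rewrite !ffunE asboolF // => /eqP.
  by rewrite oner_eq0.
have rP j : r j != 0 -> (m j)%:~R != 0 :> K /\ small_averages C (@line K _ j).
  rewrite ffunE; case: asboolP => [_|ntj _]; first by rewrite eqxx.
  split; first exact: intr_neq0_of_reduced.
  have [//|aej] := ae_trivial_dichotomy (uV j).
  move=> J q B e qP e0.
  have /choice[c cP] : forall k, exists c, c != 0 /\ q k = fun x => single j (c * x).
    by move=> k; exact: qP.
  have [|X [Xn XB Xe]] := small_line_averages enK_surj infK aej (c := c) B _ e0.
    by move=> k; case: (cP k).
  exists X; split=> // k; apply: le_trans (Xe k).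
  by apply: ler_sum => x _; case: (cP k) => _ ->; rewrite /C vec_single.
split.
  exact: (weights_vanish infK C0 Cpos Cinv Cpos Cinv m_inj m0 r0 rP).
exact: (weights_vanish infK C0 Cpos Cinv Spos Sinv m_inj m0 r0 rP).
Qed.
End ergodic_weights.

(** * Product structure and Haar measures *)

Lemma countable_enumeration (T : Type) (x0 : T) : countable [set: T] ->
  exists en : nat -> T, forall x, exists n, en n = x.
Proof.
move=> /countable_injP[f finj].
pose en n := if pselect (exists x, f x = n) is left e then sval (cid e) else x0.
exists en => x; exists (f x); rewrite /en; case: pselect => [e|[]]; last by exists x.
by case: (cid e) => y /= yx; apply: finj; rewrite ?in_setT.
Qed.

Lemma infinite_set_notin (T : choiceType) : infinite_set [set: T] ->
  forall B : seq T, exists x, x \notin B.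
Proof.
move=> infT B; apply: contra_notP infT => /forallNP inB.
apply: (sub_finite_set _ (finite_seq B)) => x _ /=.
by apply/negPn/negP; exact: inB.
Qed.

Lemma submod_of_Prop (K : pzRingType) (U : lmodType K) (P : U -> Prop) : P 0 ->
  (forall a u v, P u -> P v -> P (a *: u + v)) ->
  exists W : submodClosed U, forall u, (u \in W) = `[< P u >].
Proof.
move=> P0 PD; pose S : U -> bool := fun u => `[< P u >].
have SP : GRing.submod_closed S.
  split=> [|a u v]; rewrite ![_ \in _]/(S _); first by apply/asboolP.
  by move=> /asboolP Pu /asboolP Pv; apply/asboolP; exact: PD.
pose W : submodClosed U := HB.pack S
  (GRing.isSubmodClosed.Build K U S (GRing.submod_closed_semi SP)).
by exists W.
Qed.

Lemma probability_ae1 d (T : measurableType d) (R : realType) (P : probability T R)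
  (A : set T) : measurable A -> {ae P, forall x, A x} -> P A = 1%E.
Proof.
move=> mA [N [mN N0 sN]].
have CA0 : P (~` A) = 0%E by apply: subset_measure0 sN N0 => //; exact: measurableC.
have := probability_setC P (measurableC mA).
by rewrite setCK => /= ->; rewrite CA0 sube0.
Qed.

Section integral_functionals.
Context d (T : measurableType d) (R : realType) (P : probability T R).
Variables (V : zmodType) (t : T -> borel (pdual R V)) (f : T -> R).
Hypothesis mt : measurable_fun setT t.
Hypothesis bf : bounded_measurable f.

Lemma integral_like_weighted :
  integral_like (fun g : borel (pdual R V) -> R => \int[P]_x (f x * g (t x))).
Proof.
split=> [a g h bg bh|F g mF F1 Fg bg].
  have bgt := bounded_measurable_comp mt bg; have bht := bounded_measurable_comp mt bh.
  rewrite -integral_lin; [|exact: bounded_measurableM..].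
  by apply: eq_Rintegral => x _; ring.
have [mf [M fM]] := bf.
apply: (@integral_bounded_cvg _ _ _ _ _ _ M) => [n|n x||].
- apply: measurable_funM => //; exact: measurableT_comp (mF n) mt.
- rewrite normrM -[leRHS]mulr1 ler_pM //; exact: F1.
- by apply: aeW => x; apply: cvgMr; exact: Fg.
- by apply: bounded_measurableM => //; exact: bounded_measurable_comp mt bg.
Qed.
End integral_functionals.

Lemma integral_like_sub (R : realType) (V : zmodType) k
    (L L' : (borel (pdual R V) -> R) -> R) :
  integral_like L -> integral_like L' -> integral_like (fun g => L g - k * L' g).
Proof.
move=> [Ll Lc] [L'l L'c]; split=> [a g h bg bh|F g mF F1 Fg bg].
  by rewrite Ll // L'l //; ring.
by apply: cvgB; [exact: Lc|apply: cvgMr; exact: L'c].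
Qed.

Section product_of_haar.
Variables (R : realType) (K : fieldType) (V : lmodType K).
Variable en : nat -> V.
Hypothesis en_surj : forall v, exists n, en n = v.
Variables (s : nat) (Vs : 'I_s -> submodClosed V).
Variable theta : probability (borel (pdual R V)) R.

Notation res i := (dual_map (\val : sub_lmod (Vs i) -> V)).

Lemma sub_enumeration i : exists eU : nat -> sub_lmod (Vs i),
  forall v, exists n, eU n = v.
Proof.
exists (fun n => insubd 0 (en n)) => v; have [n vn] := en_surj (val v).
by exists n; rewrite vn valKd.
Qed.

Lemma measurable_restriction i : measurable_fun setT
  (res i : borel (pdual R V) -> borel (pdual R (sub_lmod (Vs i)))).
Proof. have [eU eU_surj] := sub_enumeration i; exact: measurable_dual_map eU_surj. Qed.

Hypothesis fourier_zero : forall (u : 'I_s -> V) i, (forall j, u j \in Vs j) ->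
  ~ ae_trivial_on theta (u i) ->
  fourier_re theta (\sum_j u j) = 0 /\ fourier_im theta (\sum_j u j) = 0.

Lemma ae_trivial_on0 : ae_trivial_on theta 0.
Proof. by apply: aeW => xi k; rewrite scaler0 char0. Qed.

Lemma ae_trivial_onD a u v : ae_trivial_on theta u -> ae_trivial_on theta v ->
  ae_trivial_on theta (a *: u + v).
Proof.
move=> tu tv; apply: filterS (filterI tu tv) => xi [xu xv] k.
by case: (pdual_funP xi) => _ xiD; rewrite scalerDr xiD scalerA xu xv mulr1.
Qed.

(** The product of two characters is a combination of the characters u + v and
u - v. *)
Lemma weighted_products_zero (f : borel (pdual R V) -> R) (u v : V) :
  bounded_measurable f ->
  \int[theta]_xi (f xi * re (u + v) xi) = 0 ->
  \int[theta]_xi (f xi * im (u + v) xi) = 0 ->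
  \int[theta]_xi (f xi * re (u - v) xi) = 0 ->
  \int[theta]_xi (f xi * im (u - v) xi) = 0 ->
  [/\ \int[theta]_xi (f xi * re u xi * re v xi) = 0,
      \int[theta]_xi (f xi * re u xi * im v xi) = 0,
      \int[theta]_xi (f xi * im u xi * re v xi) = 0 &
      \int[theta]_xi (f xi * im u xi * im v xi) = 0].
Proof.
move=> bf p1 p2 q1 q2.
have bfre w : bounded_measurable (fun xi => f xi * re w xi).
  by apply: bounded_measurableM => //; exact: bounded_measurable_re.
have bfim w : bounded_measurable (fun xi => f xi * im w xi).
  by apply: bounded_measurableM => //; exact: bounded_measurable_im.
have comb (g h k : borel (pdual R V) -> R) (a b : R) : bounded_measurable g ->
    bounded_measurable h -> \int[theta]_xi g xi = 0 -> \int[theta]_xi h xi = 0 ->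
    (forall xi, k xi = a * g xi + b * h xi) -> \int[theta]_xi k xi = 0.
  move=> bg bh g0 h0 kE; under eq_Rintegral do rewrite kE.
  rewrite integral_lin //; last exact: bounded_measurableZ.
  by rewrite integral_scale // g0 h0 !mulr0 addr0.
split.
- apply: (comb _ _ _ (1 / 2) (1 / 2) (bfre (u + v)) (bfre (u - v))) => // xi.
  by rewrite !reD reN imN; field.
- apply: (comb _ _ _ (1 / 2) (- (1 / 2)) (bfim (u + v)) (bfim (u - v))) => // xi.
  by rewrite !imD reN imN; field.
- apply: (comb _ _ _ (1 / 2) (1 / 2) (bfim (u + v)) (bfim (u - v))) => // xi.
  by rewrite !imD reN imN; field.
- apply: (comb _ _ _ (- (1 / 2)) (1 / 2) (bfre (u + v)) (bfre (u - v))) => // xi.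
  by rewrite !reD reN imN; field.
Qed.

Section rectangles.
Variable A : forall i, set (borel (pdual R (sub_lmod (Vs i)))).
Arguments A i : clear implicits.
Hypothesis mA : forall i, measurable (A i).

Definition rectangle_indicator (S : seq 'I_s) (xi : borel (pdual R V)) : R :=
  \prod_(i <- S) \1_(A i) (res i xi).

Lemma bounded_measurable_rectangle S : bounded_measurable (rectangle_indicator S).
Proof.
rewrite /rectangle_indicator; elim: S => [|i S IH].
  by under eq_fun do rewrite big_nil; exact: bounded_measurable_cst.
under eq_fun do rewrite big_cons; apply: bounded_measurableM => //.
exact: (bounded_measurable_comp (@measurable_restriction i)
  (bounded_measurable_indic R (@mA i))).
Qed.

(** If f has the same correlation with all characters of V_i as the constant k, then
it has the same correlation with all Borel sets of the dual of V_i. *)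
Lemma restriction_functional0 i f (k : R) : bounded_measurable f ->
  (forall v : V, v \in Vs i ->
     \int[theta]_xi (f xi * re v xi) = k * fourier_re theta v /\
     \int[theta]_xi (f xi * im v xi) = k * fourier_im theta v) ->
  \int[theta]_xi (f xi * \1_(A i) (res i xi)) =
  k * \int[theta]_xi \1_(A i) (res i xi).
Proof.
move=> bf fk; have [eU eU_surj] := sub_enumeration i.
pose L (g : borel (pdual R (sub_lmod (Vs i))) -> R) :=
  \int[theta]_xi (f xi * g (res i xi)) - k * \int[theta]_xi (1 * g (res i xi)).
have LI : integral_like L.
  apply: integral_like_sub; apply: integral_like_weighted => //.
  - exact: measurable_restriction.
  - exact: measurable_restriction.
  - exact: bounded_measurable_cst.
have := @functional_borel R _ eU eU_surj L LI _ _ (A i) (@mA i).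
rewrite /L; under [X in _ - _ * X]eq_Rintegral do rewrite mul1r.
move=> H; apply/eqP; rewrite -subr_eq0; apply/eqP/H => v.
  under [X in _ - _ * X]eq_Rintegral do rewrite mul1r.
  by have [-> _] := fk (val v) (valP v); rewrite subrr.
under [X in _ - _ * X]eq_Rintegral do rewrite mul1r.
by have [_ ->] := fk (val v) (valP v); rewrite subrr.
Qed.

(** The indicator functions of rectangles are introduced one factor at a time. With
the factor i, the function to be integrated is tested against the characters of V_i;
multiplying these with the character of u gives characters of u + v and u - v,
whose component j is still u_j. *)
Lemma rectangle_fourier_zero S (u : 'I_s -> V) j : uniq S ->
  (forall i, u i \in Vs i) -> (forall i, i \in S -> u i = 0) ->
  ~ ae_trivial_on theta (u j) ->
  \int[theta]_xi (rectangle_indicator S xi * re (\sum_i u i) xi) = 0 /\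
  \int[theta]_xi (rectangle_indicator S xi * im (\sum_i u i) xi) = 0.
Proof.
elim: S u => [|i S IH] u; rewrite /rectangle_indicator.
  move=> _ uV _ uj; under eq_Rintegral do rewrite big_nil mul1r.
  under [in X in _ /\ X]eq_Rintegral do rewrite big_nil mul1r.
  exact: fourier_zero uV uj.
move=> /= /andP[iS uS] uV u0 uj.
have ij : i != j.
  apply/eqP => ij; apply: uj; rewrite -ij u0 ?mem_head //; exact: ae_trivial_on0.
have shift (v : V) : v \in Vs i ->
    \int[theta]_xi (rectangle_indicator S xi * re (\sum_i u i + v) xi) = 0 /\
    \int[theta]_xi (rectangle_indicator S xi * im (\sum_i u i + v) xi) = 0.
  move=> vi; pose u' k := if k == i then v else u k.
  have -> : \sum_k u k + v = \sum_k u' k.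
    rewrite (bigD1 i) //= [RHS](bigD1 i) //= u0 ?mem_head // add0r addrC /u' eqxx.
    by congr (_ + _); apply: eq_bigr => k /negPf ->.
  apply: IH => // [k|k kS|]; rewrite /u'.
  - by case: eqP => [->|].
  - by case: eqP => [ki|_]; [rewrite -ki kS in iS|apply: u0; rewrite inE kS orbT].
  - by rewrite eq_sym (negPf ij).
have brect := bounded_measurable_rectangle S.
have bre v := bounded_measurable_re R (V := V) v.
have bim v := bounded_measurable_im R (V := V) v.
have zero (h : borel (pdual R V) -> R) : bounded_measurable h ->
    (forall v : V, v \in Vs i ->
       \int[theta]_xi (rectangle_indicator S xi * h xi * re v xi) = 0 /\
       \int[theta]_xi (rectangle_indicator S xi * h xi * im v xi) = 0) ->
    \int[theta]_xi (rectangle_indicator (i :: S) xi * h xi) = 0.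
  move=> bh h0; have := @restriction_functional0 i
    (fun xi => rectangle_indicator S xi * h xi) 0 (bounded_measurableM brect bh).
  rewrite mul0r => H; rewrite -[RHS]H => [|v vi].
    by apply: eq_Rintegral => xi _; rewrite /rectangle_indicator big_cons; ring.
  by rewrite !mul0r; exact: h0.
have VsN (v : V) : v \in Vs i -> - v \in Vs i by move=> vi; rewrite -scaleN1r rpredZ.
have key v (vi : v \in Vs i) := weighted_products_zero brect
  (shift v vi).1 (shift v vi).2 (shift _ (VsN v vi)).1 (shift _ (VsN v vi)).2.
by split; apply: zero => // v /key[].
Qed.

Lemma single_support_sum (i : 'I_s) (v : V) : \sum_j (if j == i then v else 0) = v.
Proof. by rewrite (bigD1 i) //= eqxx big1 ?addr0 // => j /negPf ->. Qed.

(** Independence of the restrictions to the V_i: given the factors in S, a character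
v of V_i has the mean value that it has without them, which is 1 or 0 according to
whether almost every xi is trivial on K v. *)
Lemma rectangle_integral S : uniq S ->
  \int[theta]_xi rectangle_indicator S xi =
  \prod_(i <- S) \int[theta]_xi \1_(A i) (res i xi).
Proof.
elim: S => [_|i S IH /= /andP[iS uS]].
  rewrite big_nil -[RHS](integral_cst_prob theta); apply: eq_Rintegral => xi _.
  by rewrite /rectangle_indicator big_nil.
rewrite big_cons -IH // mulrC.
rewrite -(@restriction_functional0 i (rectangle_indicator S)) => [||v vi].
- by apply: eq_Rintegral => xi _; rewrite /rectangle_indicator big_cons mulrC.
- exact: bounded_measurable_rectangle.
have [tv|ntv] := pselect (ae_trivial_on theta v).
  have re1 : {ae theta, forall xi : borel (pdual R V), re v xi = 1 /\ im v xi = 0}.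
    apply: filterS tv => xi /(_ 1); rewrite scale1r => xiv.
    by rewrite /re /im xiv.
  rewrite /fourier_re /fourier_im.
  rewrite (@integral_ae _ _ _ theta (re v) (fun xi => 1)); last 3 first.
  - exact: bounded_measurable_re.
  - exact: bounded_measurable_cst.
  - by apply: filterS re1 => xi [].
  rewrite (@integral_ae _ _ _ theta (im v) (fun xi => 0)); last 3 first.
  - exact: bounded_measurable_im.
  - exact: bounded_measurable_cst.
  - by apply: filterS re1 => xi [].
  rewrite !integral_cst_prob mulr1 mulr0; split.
    apply: integral_ae.
    + apply: bounded_measurableM; last exact: bounded_measurable_re.
      exact: bounded_measurable_rectangle.
    + exact: bounded_measurable_rectangle.
    + by apply: filterS re1 => xi [-> _]; rewrite mulr1.
  rewrite -[RHS](integral_cst_prob theta); apply: integral_ae.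
  + apply: bounded_measurableM; last exact: bounded_measurable_im.
    exact: bounded_measurable_rectangle.
  + exact: bounded_measurable_cst.
  + by apply: filterS re1 => xi [_ ->]; rewrite mulr0.
pose u k := if k == i then v else 0.
have uV k : u k \in Vs k by rewrite /u; case: eqP => [->|_] //; exact: rpred0.
have ui : ~ ae_trivial_on theta (u i) by rewrite /u eqxx.
rewrite -(single_support_sum i v) -/u.
have [-> ->] := fourier_zero uV ui; rewrite !mulr0.
apply: (rectangle_fourier_zero (j := i)) => // k kS.
by rewrite /u; case: eqP => // ki; rewrite -ki kS in iS.
Qed.
End rectangles.
End product_of_haar.

Section haar_from_fourier.
Variables (R : realType) (K : fieldType) (U : lmodType K) (en : nat -> U).
Hypothesis en_surj : forall v, exists n, en n = v.
Variables (W : {pred U}) (mu : probability (borel (pdual R U)) R).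
Hypothesis mu_on : forall v, v \in W ->
  mu ([set xi : pdual R U | xi v = 1] : set (borel (pdual R U))) = 1%E.
Hypothesis mu_off : forall v, v \notin W -> fourier_re mu v = 0 /\ fourier_im mu v = 0.

Lemma annihilator_full_measure :
  mu (annihilator (R := R) W : set (borel (pdual R U))) = 1%E.
Proof.
pose E n : set (borel (pdual R U)) := [set xi : pdual R U | en n \in W -> xi (en n) = 1].
have annE : annihilator W = \bigcap_n E n :> set (borel (pdual R U)).
  apply/seteqP; split=> [xi xiW n _ nW|xi xiE v]; first exact: xiW.
  by have [n <-] := en_surj v; exact: xiE.
have mE n : measurable (E n).
  have [nW|nW] := boolP (en n \in W); last first.
    rewrite (_ : E n = setT) //; apply/seteqP; split=> xi //= _.
    by move=> nW'; rewrite nW' in nW.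
  rewrite (_ : E n = [set xi : pdual R U | xi (en n) = 1]); first exact: measurable_char_eq1.
  by apply/seteqP; split=> xi /= h; [exact: h|move=> _; exact: h].
rewrite annE; apply: probability_ae1; first exact: bigcapT_measurable.
have : {ae mu, forall xi, forall n, E n xi}.
  apply: ae_foralln => n; have [nW|nW] := boolP (en n \in W); last first.
    by apply: aeW => xi nW'; rewrite nW' in nW.
  have m1 := @measurable_char_eq1 R U (en n).
  exists (~` ([set xi : pdual R U | xi (en n) = 1] : set (borel (pdual R U)))).
  split; [exact: measurableC| |by move=> xi /= + xi1; apply => _].
  have := probability_setC mu m1; rewrite (mu_on nW) subee // => ->.
by apply: filterS => xi xiE n _; exact: xiE.
Qed.

Lemma re_mul eta xi v : re v (pdual_mul eta xi : pdual R U) =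
  re v eta * re v xi - im v eta * im v xi.
Proof.
rewrite /re /im (_ : pdual_mul eta xi v = eta v * xi v) //.
by case: (eta v) => a b; case: (xi v).
Qed.

Lemma im_mul eta xi v : im v (pdual_mul eta xi : pdual R U) =
  re v eta * im v xi + im v eta * re v xi.
Proof.
rewrite /re /im (_ : pdual_mul eta xi v = eta v * xi v) //.
by case: (eta v) => a b; case: (xi v).
Qed.

Lemma measurable_pdual_mul eta :
  measurable_fun setT (pdual_mul eta : borel (pdual R U) -> borel (pdual R U)).
Proof.
have mre v : measurable_fun setT (re v : borel (pdual R U) -> R).
  by case: (bounded_measurable_re R v).
have mim v : measurable_fun setT (im v : borel (pdual R U) -> R).
  by case: (bounded_measurable_im R v).
apply: (measurable_into_dual en_surj) => v.
  under eq_fun do rewrite re_mul; apply: measurable_funB;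
    by apply: measurable_funM => //; exact: measurable_cst.
under eq_fun do rewrite im_mul; apply: measurable_funD;
  by apply: measurable_funM => //; exact: measurable_cst.
Qed.

Lemma translation_invariant eta (A : set (borel (pdual R U))) :
  annihilator (R := R) W eta -> measurable A ->
  mu (pdual_mul eta @^-1` A) = mu A.
Proof.
move=> etaW mA; have mm := measurable_pdual_mul eta.
pose L (g : borel (pdual R U) -> R) :=
  \int[mu]_xi (1 * g (pdual_mul eta xi)) - 1 * \int[mu]_xi (1 * g xi).
have LI : integral_like L.
  apply: integral_like_sub.
    by apply: (integral_like_weighted _ mm); exact: bounded_measurable_cst.
  apply: (@integral_like_weighted _ _ _ mu _ id); first exact: measurable_id.
  exact: bounded_measurable_cst.
have bre v := bounded_measurable_re R v : bounded_measurable (re v : borel (pdual R U) -> R).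
have bim v := bounded_measurable_im R v : bounded_measurable (im v : borel (pdual R U) -> R).
have LA : L \1_A = 0.
  apply: (functional_borel en_surj LI) mA => v; rewrite /L mul1r.
    rewrite -[X in X - _]/(\int[mu]_xi (1 * re v (pdual_mul eta xi))).
    under eq_Rintegral do rewrite mul1r re_mul.
    under [X in _ - X]eq_Rintegral do rewrite mul1r.
    have [vW|vW] := boolP (v \in W).
      have e1 : eta v = 1 by exact: etaW.
      have re1 : re v eta = 1 by exact/char_eq1.
have im1 : im v eta = 0 by rewrite /im e1.
under eq_Rintegral do rewrite re1 im1 mul1r mul0r subr0.
      by rewrite subrr.
    have [r0 i0] := mu_off vW.
    under eq_Rintegral do rewrite -mulNr.
    rewrite integral_lin //; last exact: bounded_measurableZ.
    rewrite integral_scale // -/(fourier_re mu v) -/(fourier_im mu v) r0 i0.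
    by rewrite !mulr0 addr0 subr0.
  under eq_Rintegral do rewrite mul1r im_mul.
  under [X in _ - X]eq_Rintegral do rewrite mul1r.
  have [vW|vW] := boolP (v \in W).
    have e1 : eta v = 1 by exact: etaW.
    have re1 : re v eta = 1 by exact/char_eq1.
have im1 : im v eta = 0 by rewrite /im e1.
under eq_Rintegral do rewrite re1 im1 mul1r mul0r addr0.
    by rewrite subrr.
  have [r0 i0] := mu_off vW.
  rewrite integral_lin //; last exact: bounded_measurableZ.
  rewrite integral_scale // -/(fourier_re mu v) -/(fourier_im mu v) r0 i0.
  by rewrite !mulr0 addr0 subr0.
have mpre : measurable (pdual_mul eta @^-1` A : set (borel (pdual R U))).
  by rewrite -[X in measurable X]setTI; exact: mm.
have finE : fine (mu (pdual_mul eta @^-1` A)) = fine (mu A).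
  rewrite -!integral_indic_prob //; apply/eqP; rewrite -subr_eq0; apply/eqP.
  rewrite -LA /L mul1r; congr (_ - _); apply: eq_Rintegral => xi _; rewrite mul1r //.
by rewrite -[LHS]fineK ?fin_num_measure // finE fineK ?fin_num_measure.
Qed.

(** A translation by eta multiplies the Fourier coefficient at v by eta v, hence it
preserves the Fourier coefficients, which vanish off W, if eta is trivial on W. *)
Lemma haar_from_fourier : is_haar_probability (annihilator (R := R) W) mu.
Proof.
split; first exact: annihilator_full_measure.
by move=> eta A etaW mA; exact: translation_invariant.
Qed.
End haar_from_fourier.

Theorem theorem1p19 (R : realType) (K : fieldType) (V : lmodType K)
  (rho : K -> {linear V -> V}) (s : nat) (Vs : 'I_s -> submodClosed V)
  (m : 'I_s -> int) :
  countable [set: K] -> infinite_set [set: K] -> countable [set: V] ->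
  is_representation rho ->
  is_weight_decomposition rho Vs m ->
  reduced_weights K m ->
  (forall i, m i != 0) ->
  forall theta : probability (borel (pdual R V)) R,
    dual_invariant rho theta ->
    dual_ergodic rho theta ->
    exists (W : forall i, submodClosed (sub_lmod (Vs i)))
      (mu : forall i, probability (borel (pdual R (sub_lmod (Vs i)))) R),
      (forall i, is_haar_probability (annihilator (R := R) (W i)) (mu i)) /\
      is_product_measure theta mu.
Proof.
move=> cK iK cV _ [_ m_inj rho_weight] m_red m0 theta theta_inv theta_erg.
have [en en_surj] := countable_enumeration 0 cV.
have [enK enK_surj] := countable_enumeration 0 cK.
have infK := infinite_set_notin iK.
have vanish := fourier_vanish en_surj enK_surj infK rho_weight theta_inv theta_erg
  m_inj m0 m_red.
have mres i := @measurable_restriction R K V en en_surj s Vs i.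
pose WP i := @submod_of_Prop K (sub_lmod (Vs i)) (fun v => ae_trivial_on theta (val v))
  (ae_trivial_on0 theta) (fun a u v => @ae_trivial_onD R K V theta a (val u) (val v)).
pose W i := sval (cid (WP i)).
have WE i v : (v \in W i) = `[< ae_trivial_on theta (val v) >] := svalP (cid (WP i)) v.
pose muP i := cid (image_probability theta (mres i)).
pose mu i := sval (muP i).
have muE i A : mu i A = theta (_ @^-1` A) := (svalP (muP i)).1 A.
have mu_int i g (bg : bounded_measurable g) : \int[mu i]_xi g xi = _ := (svalP (muP i)).2 g bg.
exists W, mu; split=> [i|A mA].
  have [eU eU_surj] := sub_enumeration en_surj Vs i.
  apply: (haar_from_fourier eU_surj) => v.
    rewrite WE => /asboolP tv; rewrite muE.
    have := @measurable_char_eq1 R V (val v) => m1.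
    apply: probability_ae1; first exact: m1.
    by apply: filterS tv => xi /(_ 1); rewrite scale1r.
  rewrite WE => /asboolP ntv; pose u k := if k == i then val v else 0.
  have uV k : u k \in Vs k.
    by rewrite /u; case: eqP => [->|_]; [exact: (valP v)|exact: rpred0].
  have ui : ~ ae_trivial_on theta (u i) by rewrite /u eqxx.
  have := vanish u i uV ui; rewrite /u single_support_sum /fourier_re /fourier_im.
  rewrite !mu_int //; [exact: bounded_measurable_im|exact: bounded_measurable_re].
have mB : measurable ([set xi | forall i, A i (dual_map \val xi)] : set (borel (pdual R V))).
  have -> : [set xi | forall i, A i (dual_map \val xi)] =
      \bigcap_(i in [set: 'I_s]) (dual_map \val @^-1` A i) :> set (borel (pdual R V)).
    by apply/seteqP; split=> xi /= h i; [move=> _; exact: h|exact: h i I].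
  apply: fin_bigcap_measurable => // i _.
  by rewrite -[X in measurable X]setTI; exact: (mres i measurableT _ (mA i)).
have mpre i : measurable (dual_map \val @^-1` A i : set (borel (pdual R V))).
  by rewrite -[X in measurable X]setTI; exact: (mres i measurableT _ (mA i)).
have real_eq : fine (theta [set xi | forall i, A i (dual_map \val xi)]) =
    \prod_(i < s) fine (mu i (A i)).
  rewrite -integral_indic_prob //.
  transitivity (\int[theta]_xi rectangle_indicator A (enum 'I_s) xi).
    apply: eq_Rintegral => xi _; rewrite /rectangle_indicator big_enum /= indicE.
    have [/set_mem xiA|/negP xiA] := boolP (_ \in _).
      by rewrite big1 // => i _; rewrite indicE mem_set.
    have /existsNP[i Ai] : ~ forall i, A i (dual_map \val xi).
      by move=> h; apply: xiA; exact: mem_set.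
    by rewrite (bigD1 i) //= indicE memNset // mul0r.
  rewrite (rectangle_integral en_surj vanish) ?enum_uniq // big_enum /=.
  apply: eq_bigr => i _; rewrite -(integral_indic_prob (mu i) (mA i)).
  by rewrite (mu_int i _ (bounded_measurable_indic _ (mA i))).
rewrite -[LHS]fineK ?fin_num_measure // real_eq (big_morph EFin EFinM erefl).
by apply: eq_bigr => i _; rewrite fineK ?fin_num_measure.
Qed.
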